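(* For every integer $d\ge 3$ there exists a constant $c_d>0$, depending only on $d$, such that $$c_d\, n^{K_d-\delta_d}\le m_d(n)\le (2n+1)^{K_d}\qquad\text{for every integer } n\ge 1 .$$
   Context: Let $e_1,\dots,e_d$ be the standard basis of $\mathbb{Z}^d$ and, for $u:\mathbb{Z}^d\to\mathbb{C}$, let $(A_du)(x)=\sum_{i=1}^d\bigl(u(x+e_i)+u(x-e_i)\bigr)$. The function $u$ is called discrete harmonic if $A_du=2d\,u$ on all of $\mathbb{Z}^d$. Let $\operatorname{supp}(u)=\{x\in\mathbb{Z}^d:u(x)\ne0\}$ and $Q_n^{(d)}=\{-n,-n+1,\dots,n\}^d$. Define $$m_d(n)=\inf\bigl\{\,|\operatorname{supp}(u)\cap Q_n^{(d)}| : u:\mathbb{Z}^d\to\mathbb{C},\ A_du=2du,\ u(0)\ne 0\,\bigr\}.$$ Set $K_d=\lfloor d/2\rfloor+1$. Set $\delta_d=0$ for $d=2,3$, and for $d\ge4$ set $\delta_d=1-\dfrac{d}{2(2d-1)}$ if $d$ is even and $\delta_d=\dfrac{d-1}{2(2d-1)}$ if $d$ is odd. *)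

(* Defs.v *)
From mathcomp Require Import all_boot all_order all_algebra.
From mathcomp Require Import finmap complex.
From mathcomp Require Import all_classical all_reals all_analysis.

Set Implicit Arguments.
Unset Strict Implicit.
Unset Printing Implicit Defensive.

Import Order.TTheory GRing.Theory Num.Theory.

Local Open Scope classical_set_scope.
Local Open Scope ring_scope.

(* The lattice Z^d is 'rV[int]_d, with standard basis vectors delta_mx 0 i;
   the complex numbers are R[i] for a realType R. *)

Definition adjacency (R : realType) (d : nat) (u : 'rV[int]_d -> R[i]) :
    'rV[int]_d -> R[i] :=
  fun x => \sum_(i < d) (u (x + delta_mx 0 i) + u (x - delta_mx 0 i)).

Definition discrete_harmonic (R : realType) (d : nat)
    (u : 'rV[int]_d -> R[i]) : Prop :=
  forall x, adjacency u x = (2 * d)%:R * u x.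

Definition supp (R : realType) (d : nat) (u : 'rV[int]_d -> R[i]) :
    set 'rV[int]_d :=
  [set x | u x != 0].

Definition cube (d n : nat) : set 'rV[int]_d :=
  [set x | forall i : 'I_d, - n%:Z <= x 0 i <= n%:Z].
Arguments cube : clear implicits.

(* fset_set sends an infinite set to the empty one; this lemma shows that the
   cardinals taken in min_support below are the genuine ones. *)
Lemma finite_cube (d n : nat) : finite_set (cube d n).
Proof.
pose f (v : 'rV['I_(n + n).+1]_d) : 'rV[int]_d :=
  \row_i ((v 0 i : nat)%:Z - n%:Z).
apply: (@sub_finite_set _ _ (range f)); last exact/finite_image/finite_finset.
move=> x xQ; exists (\row_i inord (absz (x 0 i + n%:Z))) => //.
apply/rowP => i; rewrite !mxE.
have /andP[xl xr] : - n%:Z <= x 0 i <= n%:Z := xQ i.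
have x0 : 0 <= x 0 i + n%:Z by rewrite -lerBlDr sub0r.
rewrite inordK; first by rewrite gez0_abs // addrK.
by rewrite ltnS -lez_nat gez0_abs // PoszD lerD2r.
Qed.

(* The infimum is over a nonempty set, since constants are discrete harmonic. *)
Definition min_support (R : realType) (d n : nat) : R :=
  inf [set r : R | exists u : 'rV[int]_d -> R[i],
    [/\ discrete_harmonic u, u 0 != 0
      & r = (#|` fset_set (supp u `&` cube d n)|)%:R]].

Definition K (d : nat) : nat := (d %/ 2).+1.

Definition delta (R : realType) (d : nat) : R :=
  if (d < 4)%N then 0
  else if odd d then (d%:R - 1) / (2 * (2 * d%:R - 1))
  else 1 - d%:R / (2 * (2 * d%:R - 1)).

(* Main.v *)
Require Import Defs.
From HB Require Import structures.
From mathcomp Require Import all_boot all_order all_algebra.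
From mathcomp Require Import all_classical.
From mathcomp Require Import ring lra zify.
From mathcomp Require mpoly ssrcomplements.

Set Implicit Arguments.
Unset Strict Implicit.
Unset Printing Implicit Defensive.

Import Order.TTheory GRing.Theory Num.Theory.

Local Open Scope ring_scope.

(** Let [u] be discrete harmonic on Z^d with [u 0 != 0], and let N be the number
   of points of the box of radius n at which [u] does not vanish. Write T_i for
   the translation by the i-th basis vector, w_i = T_i - T_i^-1, and
   H = sum_i (T_i + T_i^-1) - 2d, so that H u = 0.

   Upper bound. On Z the function lam^x is an eigenfunction of the adjacency
   operator for lam + lam^-1, and on Z^2 the function (-1)^x [x = y] is one for
   the eigenvalue 0. A product of one exponential and of functions of the second
   kind, constant in the last coordinate if d is even, is harmonic for a suitable
   lam and lives on a sublattice of rank K d ([sparse_harmonic]).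

   Lower bound, d >= 4. The claim is n^(d^2) <= C N^(2d-1) ([support_bound]);
   the exponent d^2 / (2d-1) is K d - delta d ([exponentE]).
   - The commutator of H with the i-th coordinate is w_i. Hence H^k maps x^a u to
     k! w^a u if |a| = k and to 0 if |a| < k ([iter_lap_xrun]). All the functions
     x^a u vanish where u does, so that the spans of the w^a u with |a| = k, taken
     on boxes that shrink with k, have dimensions of total at most N ([sum_gdim]).
   - Consequently the polynomials of degree at most j whose homogeneous parts p_k
     all satisfy p_k(w) u = 0 on these boxes form an ideal U of codimension at
     most N in the truncated polynomial ring, and U is stable under dilations.
   - As (T_i + T_i^-1)^2 = w_i^2 + 4, the function u is also killed by R(w), where
     R is the norm of sum_i sqrt (y_i^2 + 4) - 2d ([relpoly_kill]). Near the
     origin R is a unit times h = sum_i (2 sqrt (1 + y_i^2 / 4) - 2).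
   - The dilates of h by d scalars with distinct squares generate an ideal of bounded
     codimension: all power series coefficients of h are nonzero, so that the
     ideal contains the power sums of the y_i^2, thus y_i^(2d), by Newton's
     identities ([codim_sqrt_series]). Adding k generic dilates of h to U gives
     codimensions D_k that are log-convex up to a factor 2, where D_0 <= N and
     D_d is bounded. So the codimension D_1 of U + (h) satisfies D_1^d <= C N^(d-1)
     ([codim_relpoly]).
   - D_1, plus a few of the dimensions of [sum_gdim] in degrees close to j, bounds
     the dimension of the span of the w^a u, |a| <= j ([dim_observe]). Because
     T_i^2 = w_i T_i + 1, it also bounds that of the span of the translates
     T^a u, |a| <= j ([translate_corners]).
   - If the translates T^a u with a in {0, ..., b}^d span a space of dimension D,
     then they are separated by D points. Each translate is nonzero at one of
     them, whence (b + 1)^d <= D N ([uncertainty]). With b of order n and a degree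
     j at which the additional terms are small, the bound follows.

   Lower bound, d = 3. Here N >= c n^2 has a direct geometric proof
   ([support_bound3]). Given a vertical axis, take among the nonzero values of u
   in a large octahedron around it one closest to the axis, at lateral distance r.
   By the equation u has a nonzero constant value, up to alternating signs, on a
   whole open face at that distance and height. Going down from the middle of this face
     one meets, at many
   heights, rows on which u is up to signs a polynomial of low degree, so that u
   has at least c r^2 nonzero values at lateral distance at most 2 r from the axis
   ([octa_support]). A covering argument over a square grid of axes adds these
   numbers up. *)

(** * Codimensions of sums of images *)

Section Codim.
Variables (F : fieldType) (V : vectType F).
Implicit Types (U W : {vspace V}) (f g : 'End(V)).

Definition codim U := (\dim {:V} - \dim U)%N.

Lemma codimK U : (codim U + \dim U = \dim {:V})%N.
Proof. by rewrite /codim subnK // dimvS // subvf. Qed.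

Lemma codimS U W : (U <= W)%VS -> (codim W <= codim U)%N.
Proof. by move=> UW; rewrite leq_sub2l // dimvS. Qed.

(** This is [dim A + dim B = dim (A + B) + dim (A :&: B)] for the two sums on
    the left, whose intersection contains the image of the composite. *)
Lemma codim_gluing f g U : (f \o g = g \o f)%VF ->
  (codim (U + limg f) + codim (U + limg g)
     <= codim (U + limg (f \o g)) + codim (U + limg f + limg g))%N.
Proof.
move=> fg; pose A := (U + limg f)%VS; pose B := (U + limg g)%VS.
have sAB : (U + limg (f \o g) <= A :&: B)%VS.
  rewrite subv_cap; apply/andP; split; apply: addvS => //.
    by rewrite limg_comp limgS // subvf.
  by rewrite fg limg_comp limgS // subvf.
have dAB := dimvS sAB.
have E : (A + B = U + limg f + limg g)%VS.
  by rewrite /A /B addvA [(U + _ + U)%VS]addvC addvA addvv.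
have := dimv_sum_cap A B; rewrite E => dE.
have := codimK A; have := codimK B; have := codimK (U + limg (f \o g)).
have := codimK (U + limg f + limg g).
move: dAB dE; rewrite -/A -/B.
set a := codim _; set b := codim _; set c := codim _; set e := codim _.
by lia.
Qed.

(** A complement of [U + limg g] is mapped by [f] to a space that supplements
    [U + limg (f \o g)] in [U + limg f]. *)
Lemma codim_limg_comp f g U : (f @: U <= U)%VS ->
  (codim (U + limg (f \o g)) <= codim (U + limg f) + codim (U + limg g))%N.
Proof.
move=> fU; pose C := ((U + limg g)^C)%VS.
have sC : (U + limg f <= (U + limg (f \o g)) + f @: C)%VS.
  have sU : (U <= U + limg (f \o g) + f @: C)%VS by rewrite -addvA addvSl.
  have -> : limg f = (f @: U + limg (f \o g) + f @: C)%VS.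
    by rewrite limg_comp -!limgD addv_complf.
  rewrite subv_add sU.
  rewrite 2!subv_add (subv_trans fU sU) addvSr andbT /=.
  exact: subv_trans (addvSr U _) (addvSl _ _).
have d1 := dimvS sC; have := dimv_add_leqif (U + limg (f \o g)) (f @: C).
case=> d2 _; have d3 := limg_ker_dim f C.
have := dimv_compl (U + limg g); rewrite -/C -/(codim _) => dC.
have := codimK (U + limg f); have := codimK (U + limg (f \o g)).
move: d1 d2 d3 dC; set a := codim _; set b := codim _; set c := codim _.
by lia.
Qed.

Definition composite (fs : seq 'End(V)) := foldr (fun f g => (f \o g)%VF) \1%VF fs.

Lemma composite_comm f fs : (forall g, g \in fs -> (f \o g = g \o f)%VF) ->
  (f \o composite fs = composite fs \o f)%VF.
Proof.
elim: fs => [|g fs IH] cf /=; first by rewrite comp_lfun1l comp_lfun1r.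
rewrite comp_lfunA cf ?mem_head // -!comp_lfunA IH // => h hh.
by apply: cf; rewrite inE hh orbT.
Qed.

Lemma codim_composite fs U : (forall f, f \in fs -> (f @: U <= U)%VS) ->
  (codim (U + limg (composite fs)) <= \sum_(f <- fs) codim (U + limg f))%N.
Proof.
elim: fs => [|f fs IH] sU /=.
  by rewrite big_nil /codim lim1g addvf subnn.
rewrite big_cons; apply: leq_trans (codim_limg_comp _ (sU _ (mem_head _ _))) _.
by rewrite leq_add2l IH // => h hh; apply: sU; rewrite inE hh orbT.
Qed.

(** A Bonferroni inequality. The codimension of [U] is at least that of [U +
    limg (composite fs)], and splitting off one factor at a time costs, by
    [codim_gluing], at most the codimension of the sum of two images for each
    later factor. *)
Lemma codim_pairwise fs U a b :
    (forall f, f \in fs -> (f @: U <= U)%VS) ->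
    {in fs &, forall f g, (f \o g = g \o f)%VF} ->
    (forall f, f \in fs -> a <= codim (U + limg f))%N ->
    pairwise (fun f g => codim (U + limg f + limg g) <= b)%N fs ->
  (size fs * a <= codim U + 'C(size fs, 2) * b)%N.
Proof.
move=> sU cU aU bU.
suff: (size fs * a <= codim (U + limg (composite fs)) + 'C(size fs, 2) * b)%N.
  by move=> /leq_trans; apply; rewrite leq_add2r codimS // addvSl.
elim: fs sU cU aU bU => [|f fs IH] //= sU cU aU /andP[bf bU].
have sU' g : g \in fs -> (g @: U <= U)%VS by move=> ?; rewrite sU // inE orbC; apply/orP;
  left.
have {}IH := IH sU' _ _ bU; rewrite mulSn binS bin1 mulnDl.
have c1 : (f \o composite fs = composite fs \o f)%VF.
  by apply: composite_comm => g gfs; apply: cU; rewrite inE ?eqxx ?gfs ?orbT.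
have a1 := aU _ (mem_head _ _).
have g1 := codim_gluing U c1.
have stab g : g \in fs -> (g @: (U + limg f) <= U + limg f)%VS.
  move=> gfs; rewrite limgD addvS ?sU' // -limg_comp.
  rewrite cU ?inE ?eqxx ?gfs ?orbT //.
  by rewrite limg_comp limgS // subvf.
have c2 := codim_composite stab.
have c3 : (\sum_(g <- fs) codim (U + limg f + limg g) <= size fs * b)%N.
  by rewrite -sum1_size big_distrl /= !big_seq; apply: leq_sum => g gfs;
    rewrite mul1n (allP bf).
have I2 : (size fs * a <= codim (U + limg (composite fs)) + 'C(size fs, 2) * b)%N.
  apply: IH => [g h gf hf|g gf]; first by apply: cU; rewrite inE ?gf ?hf orbT.
  by apply: aU; rewrite inE gf orbT.
have := leq_trans c2 c3; move: a1 g1 I2; clear.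
set x := codim _; set y := codim _; set z := codim _; set t := codim _.
move: (size fs * a)%N ('C(_, 2) * b)%N (size fs * b)%N x y z t => *.
by lia.
Qed.
End Codim.

(** * Generic values of bounded integer invariants *)

Local Open Scope classical_set_scope.

Section Generic.
Variable U : set_system nat.
Hypothesis UU : UltraFilter U.

(** A partition of the naturals into finitely many sets has one member in the
    ultrafilter. *)
Lemma ultra_const (c : nat -> nat) M : (forall t, c t <= M)%N ->
  exists v, U [set t | c t = v].
Proof.
elim: M => [|M IH] in c * => cM.
  by exists 0%N; apply: filterS filterT => t _ /=; have := cM t; lia.
have [UM|UM] := in_ultra_setVsetC [set t | c t = M.+1] UU; first by exists M.+1.
have [|v Uv] := IH (fun t => minn (c t) M); first by move=> t; lia.
exists v; apply: filterS (filterI UM Uv) => t /= [cN cv].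
by have := cM t; lia.
Qed.

(** The limit of a bounded sequence of naturals along the ultrafilter. *)
Definition ulim (c : nat -> nat) := xget 0%N [set v | U [set t | c t = v]].

Lemma ulimP (c : nat -> nat) M : (forall t, c t <= M)%N -> U [set t | c t = ulim c].
Proof.
move=> /ultra_const [v Uv].
by have := @xgetPex _ 0%N [set v | U [set t | c t = v]] (ex_intro _ v Uv).
Qed.

Lemma ulim_le (c : nat -> nat) M : (forall t, c t <= M)%N -> (ulim c <= M)%N.
Proof. by move=> cM; have /filter_ex [t /= <-] := ulimP cM. Qed.

End Generic.

(** The number [D k] is the iterated ultralimit of [chi] over [k] successive
    parameters, and [G] holds of the lists at which every iterated limit has
    its generic value. Finitely many lists in [G] have a common generic
    extension, as finitely many sets of an ultrafilter meet. *)
Lemma generic_values (chi : seq nat -> nat) M n : (forall I, chi I <= M)%N ->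
  exists (D : nat -> nat) (G : seq nat -> Prop),
  [/\ G [::], forall I, G I -> (size I <= n)%N -> chi I = D (size I)
    & forall (Js : seq (seq nat)) m,
      (forall J, J \in Js -> G J /\ (size J < n)%N) ->
      exists2 t, (m < t)%N & forall J, J \in Js -> G (rcons J t)].
Proof.
move=> chiM; have [U [UU evU]] := ultraFilterLemma eventually_filter.
pose L := fix L k := if k is k'.+1 then fun I => ulim U (fun t => L k' (rcons I t)) else
  chi.
have LM k : forall I, (L k I <= M)%N by elim: k => [|k IH] I //=; apply: ulim_le.
exists (fun k => L k [::]), (fun I => forall m,
  (m + size I <= n)%N -> L m I = L (m + size I)%N [::]).
split=> [m|I GI In|Js m GJ]; first by rewrite addn0.
  exact: (GI 0%N In).
have : U [set t | (m < t)%N /\ forall J, J \in Js ->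
    forall k, (k + (size J).+1 <= n)%N -> L k (rcons J t) = L (k + (size J).+1)%N [::]].
  elim: Js GJ => [_|J Js IH GJ].
    by apply: evU; exists m.+1.
  have {}IH : U _ := IH (fun J' h => GJ J' (@mem_behead _ (J :: Js) J' h)).
  have UJ N : U [set t | forall k, (k < N)%N -> L k (rcons J t) = L k.+1 J].
    elim: N => [|N IHN]; first exact: filterS filterT.
    have UN : U [set t | L N (rcons J t) = L N.+1 J] by apply: (@ulimP _ _ _ M).
    apply: filterS (filterI IHN UN) => t /= [h1 h2] k; rewrite ltnS leq_eqVlt.
    by case/orP => [/eqP->|/h1].
  apply: filterS (filterI IH (UJ n)) => t /= [[mt h1] h2]; split=> // J'.
  rewrite inE => /orP[/eqP->|/h1//] k kn; apply: etrans (h2 k _) _; first by lia.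
  have [GJJ _] := GJ J (mem_head _ _).
  by apply: etrans (GJJ k.+1 _) _; rewrite addSnnS.
move=> /filter_ex [t /= [mt h]]; exists t => // J JJs k; rewrite size_rcons => kn.
by apply: h.
Qed.
Local Close Scope classical_set_scope.

(** * Almost log-convex generic codimensions *)

(** Up to powers of 2 no ratio [a j / a j.+1] exceeds [a 0 / a 1], and the
    product of these ratios telescopes. *)
Lemma logconvex_pow (a : nat -> nat) n :
    (forall k, k <= n -> 0 < a k)%N ->
    (forall k, k.+1 < n -> a k.+1 * a k.+1 <= 2 * a k * a k.+2)%N ->
  (0 < n)%N -> (a 1%N ^ n <= 2 ^ 'C(n, 2) * a 0%N ^ n.-1 * a n)%N.
Proof.
move=> a0 ac; have R j : (j < n)%N -> (a 1 * a j <= 2 ^ j * a 0 * a j.+1)%N.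
  elim: j => [|j IH] jn; first by rewrite mul1n mulnC.
  rewrite -(leq_pmul2r (a0 j (leq_trans (leqnSn _) (ltnW jn)))).
  have := ac _ jn; have {IH} := IH (ltnW jn).
  rewrite -(leq_pmul2r (a0 j.+1 (ltnW jn))) => h1 h2.
  rewrite mulnAC; apply: leq_trans h1 _; rewrite -mulnA.
  apply: leq_trans (leq_mul (leqnn _) h2) _; rewrite expnS; apply/eq_leq; ring.
case: n a0 ac R => // n; rewrite /= => a0 ac R _.
elim: n a0 ac R => [|n IH] a0 ac R; first by rewrite !mul1n.
have {}IH : (a 1 ^ n.+1 <= 2 ^ 'C(n.+1, 2) * a 0 ^ n * a n.+1)%N.
  by apply: IH => [k kn|k kn|k kn]; [apply: a0|apply: ac|apply: R]; lia.
rewrite expnSr; apply: leq_trans (leq_mul IH (leqnn _)) _.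
rewrite -mulnA [(a n.+1 * _)%N]mulnC.
apply: leq_trans (leq_mul (leqnn _) (R _ (ltnSn _))) _.
rewrite [in leqRHS]binS bin1 expnD [(a 0 ^ n.+1)%N]expnS.
by move: (2 ^ _)%N (2 ^ _)%N => x y; apply/eq_leq; ring.
Qed.

Section GenericCodim.
Variables (F : fieldType) (V : vectType F) (U : {vspace V}) (f : nat -> 'End(V)).
Hypothesis comm : forall s t, (f s \o f t = f t \o f s)%VF.
Hypothesis stab : forall s, (f s @: U <= U)%VS.

Definition fspan (I : seq nat) := (U + \sum_(s <- I) limg (f s))%VS.

Lemma fspan_rcons I s : fspan (rcons I s) = (fspan I + limg (f s))%VS.
Proof. by rewrite /fspan -cats1 big_cat big_seq1 /= addvA. Qed.

Lemma fspan_stab I s : (f s @: fspan I <= fspan I)%VS.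
Proof.
elim/last_ind: I => [|I t IH]; first by rewrite /fspan big_nil addv0.
by rewrite fspan_rcons limgD addvS // -limg_comp comm limg_comp limgS // subvf.
Qed.

(** Let [D k] be the generic codimension after [k] images have been added to
    [U]. Adding [r] further generic ones and applying [codim_pairwise] gives
    [r D(k+1) <= D(k) + C(r,2) D(k+2)] for every [r]; a good choice of [r]
    makes [D] log-convex up to a factor 2. *)
Lemma codim_generic n a B : (0 < n)%N ->
    (forall I, 0 < codim (fspan I))%N ->
    (forall s, codim (U + limg (f s)) = a)%N ->
    (forall I, uniq I -> size I = n -> codim (fspan I) <= B)%N ->
  (a ^ n <= 2 ^ 'C(n, 2) * codim U ^ n.-1 * B)%N.
Proof.
move=> n0 pos aE bB; pose chi I := codim (fspan I).
have chiM I : (chi I <= \dim {:V})%N by rewrite leq_subr.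
have [D [G [G0 GD Gn]]] := generic_values n chiM.
have ex_gen k : (k <= n)%N -> exists I, [/\ G I, size I = k & uniq I].
  elim: k => [|k IH] kn; first by exists [::].
  have [I [GI sI uI]] := IH (ltnW kn).
  have [|t It GIt] := Gn [:: I] (sumn I).
    by move=> J; rewrite inE => /eqP->; rewrite sI.
  exists (rcons I t); split; first by apply: GIt; rewrite inE.
    by rewrite size_rcons sI.
  rewrite rcons_uniq uI andbT; apply: contraL It => tI.
  by rewrite -leqNgt sumnE (big_rem t) //= leq_addr.
have D0 : D 0%N = codim U.
  by rewrite -(GD _ G0) //= /chi /fspan big_nil addv0.
have D1 : D 1%N = a.
  have [I [GI sI _]] := ex_gen 1%N n0; case: I GI sI => [|t [|]] //= GI _.
  by rewrite -(GD _ GI) //= /chi /fspan big_seq1.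
have DB : (D n <= B)%N.
  by have [I [GI sI uI]] := ex_gen n (leqnn _); rewrite -sI -GD ?sI // bB.
have Dpos k : (k <= n)%N -> (0 < D k)%N.
  by move=> kn; have [I [GI sI uI]] := ex_gen k kn; rewrite -sI -GD ?sI // pos.
have Dineq k r : (k.+1 < n)%N -> (r * D k.+1 <= D k + 'C(r, 2) * D k.+2)%N.
  move=> kn; have [I [GI sI _]] := ex_gen k (ltnW (ltnW kn)).
  have [ts [sz Gts pts]] : exists ts : seq nat, [/\ size ts = r,
       forall t, t \in ts -> G (rcons I t) &
       pairwise (fun x y => `[< G (rcons (rcons I y) x) >]) ts].
    elim: {Dpos DB} r => [|r [ts [sz Gts pts]]]; first by exists [::].
    have [|t _ Gt] := Gn (I :: [seq rcons I y | y <- ts]) 0%N.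
      move=> J; rewrite inE => /orP[/eqP->|/mapP[y yts ->]].
        by rewrite sI; split=> //; lia.
      by rewrite size_rcons sI; split; [apply: Gts|].
    exists (t :: ts); split; first by rewrite /= sz.
      by move=> x; rewrite inE => /orP[/eqP->|/Gts//]; apply: Gt; rewrite mem_head.
    rewrite /= pts andbT; apply/allP => y yts; apply/asboolP/Gt.
    by rewrite inE map_f ?orbT.
  have := @codim_pairwise _ V (map f ts) (fspan I) (D k.+1) (D k.+2).
  have -> : codim (fspan I) = D k.
    by have := GD _ GI; rewrite sI /chi => ->//; lia.
  rewrite size_map sz; apply.
  - by move=> _ /mapP[s _ ->]; apply: fspan_stab.
  - by move=> _ _ /mapP[s _ ->] /mapP[t _ ->]; apply: comm.
  - move=> _ /mapP[s sts ->]; rewrite -fspan_rcons -/(chi _) GD ?size_rcons ?sI //.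
      exact: Gts.
    by lia.
  - rewrite pairwise_map; apply: sub_pairwise pts => x y /asboolP Gxy.
    by rewrite /= -addvA [(limg _ + _)%VS]addvC addvA -!fspan_rcons -/(chi _) GD
      ?size_rcons ?sI.
rewrite -D1 -D0; apply: leq_trans (_ : 2 ^ 'C(n, 2) * D 0 ^ n.-1 * D n <= _)%N; last first.
  by rewrite leq_mul2l DB orbT.
apply: logconvex_pow => // k kn.
have p2 : (0 < D k.+2)%N by apply: Dpos.
(* The choice r = q + 1 is the best one up to rounding. *)
set q := (D k.+1 %/ D k.+2)%N; have := Dineq k q.+1 kn.
have h1 : (q * D k.+2 <= D k.+1)%N by apply: leq_trunc_div.
have h2 : (D k.+1 < q.+1 * D k.+2)%N by rewrite ltn_ceil.
have h3 : (2 * 'C(q.+1, 2) = q.+1 * q)%N by rewrite -mul_bin_diag bin1.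
have h4 : (2 * ('C(q.+1, 2) * D k.+2) = q.+1 * q * D k.+2)%N by rewrite mulnA h3.
have h5 : (q.+1 * q * D k.+2 <= q.+1 * D k.+1)%N by rewrite -mulnA leq_mul2l h1 orbT.
move=> h7; have h6 : (q.+1 * D k.+1 <= 2 * D k)%N.
  move: h4 h5 h7; move: ('C(_, _) * _)%N (q.+1 * q * D k.+2)%N (q.+1 * D _)%N => x y z.
  by move: (D k) => w *; lia.
apply: leq_trans (leq_mul (leqnn _) (ltnW h2)) _.
rewrite mulnA [(_ * q.+1)%N]mulnC; exact: leq_mul.
Qed.
End GenericCodim.

(** * Newton's identities and a square root series *)

Section Newton.
Variable A : idomainType.
Implicit Types r : seq A.

Definition rootpoly r : {poly A} := \prod_(x <- r) ('X - x%:P).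

(** The logarithmic derivative of a product of linear factors, with cleared
    denominators. *)
Lemma deriv_rootpoly r : exists2 g : nat -> {poly A},
  forall i, (i < size r)%N -> ('X - (r`_i)%:P) * g i = rootpoly r
  & 'X * (rootpoly r)^`() = rootpoly r *+ size r + \sum_(i < size r) r`_i *: g i.
Proof.
elim: r => [|y r [g gP gE]].
  by exists (fun=> 0) => //; rewrite /rootpoly big_nil derivC mulr0 mulr0n big_ord0 addr0.
exists (fun i => if i is i'.+1 then ('X - y%:P) * g i' else rootpoly r).
  by move=> [|i] /= ir; rewrite /rootpoly big_cons // mulrCA gP.
rewrite big_ord_recl /= /rootpoly big_cons -/(rootpoly r) derivM derivXsubC mul1r.
rewrite mulrDr mulrCA gE mulrDr.
rewrite [X in _ = _ + (_ + X)](eq_bigr (fun i : 'I__ => ('X - y%:P) * (r`_i *: g i)));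
  last first.
  by move=> i _ /=; rewrite add0n -!mul_polyC; ring.
rewrite -mulr_sumr; move: (\sum_(i < _) _) => S.
rewrite mulrnAr mulrSr -!mul_polyC; ring.
Qed.

Lemma size_rootpoly r : size (rootpoly r) = (size r).+1.
Proof. by rewrite /rootpoly size_prod_XsubC. Qed.

(** Newton's identities, obtained by comparing coefficients in
    [deriv_rootpoly]; [g i] is computed by Horner's scheme, whose steps
    telescope. *)
Lemma newton r s : (s <= size r)%N ->
  (rootpoly r)`_s *+ s = (rootpoly r)`_s *+ size r
     + \sum_(s <= k < size r) (rootpoly r)`_k.+1 * \sum_(i < size r) r`_i ^+ (k.+1 - s).
Proof.
move=> sr; have [g gP gE] := deriv_rootpoly r.
have := congr1 (fun p : {poly A} => p`_s) gE.
rewrite /= coefXM coefD coefMn coef_sum.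
have -> : (if s == 0%N then 0 else ((rootpoly r)^`())`_s.-1) = (rootpoly r)`_s *+ s.
  by case: s {sr} => [|s] /=; rewrite ?mulr0n // coef_deriv.
move->; congr (_ + _).
under [in RHS]eq_bigr do rewrite mulr_sumr.
rewrite exchange_big /=; apply: eq_bigr => i _; rewrite coefZ.
rewrite (eq_big_nat _ _ (F2 := fun k => - (r`_i ^+ (k.+2 - s) * (g i)`_k.+1
          - r`_i ^+ (k.+1 - s) * (g i)`_k))).
  rewrite sumrN telescope_sumr //.
  have -> : (g i)`_(size r) = 0.
    apply: nth_default; have := size_rootpoly r; rewrite -(gP i) //.
    have [->|gn0] := eqVneq (g i) 0; first by rewrite size_poly0.
    by rewrite size_monicM ?monicXsubC // size_XsubC /= => -[]; lia.
  by rewrite subSnn mulr0 sub0r opprK.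
move=> k /andP[sk kr]; rewrite -(gP i) // mulrBl coefB coefXM /= coefCM.
have -> : (k.+2 - s = (k.+1 - s).+1)%N by lia.
by rewrite exprS; ring.
Qed.

Lemma rootpolyX r i : (i < size r)%N ->
  r`_i ^+ size r = - \sum_(k < size r) (rootpoly r)`_k * r`_i ^+ k.
Proof.
move=> ir; have : (rootpoly r).[r`_i] = 0.
  by apply/rootP; rewrite root_prod_XsubC mem_nth.
rewrite horner_coef size_rootpoly big_ord_recr /=.
have : rootpoly r \is monic by apply: monic_prod_XsubC.
rewrite monicE /lead_coef size_rootpoly => /eqP ->; rewrite mul1r.
by move/eqP; rewrite addrC addr_eq0 => /eqP.
Qed.
End Newton.

Section Sqrt.
Variable F : numFieldType.

(** The Taylor coefficients of [2 sqrt (1 + x / 4)]. *)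
Fixpoint sqrt_coef k : F :=
  if k is k'.+1 then sqrt_coef k' * (2^-1 - k'%:R) / (4 * k'.+1%:R) else 2.

Lemma sqrt_coefS k : sqrt_coef k.+1 * (4 * k.+1%:R) = sqrt_coef k * (2^-1 - k%:R).
Proof. by rewrite /= divfK // mulf_neq0 ?pnatr_eq0. Qed.

Lemma sqrt_coef_neq0 k : sqrt_coef k != 0.
Proof.
elim: k => [|k IH] /=; first by rewrite pnatr_eq0.
rewrite mulf_neq0 ?invr_neq0 ?mulf_neq0 ?pnatr_eq0 //.
rewrite subr_eq0; apply: contraTneq isT => h.
have : (2 * k)%:R = 1 :> F by rewrite natrM -h divff ?pnatr_eq0.
by move/eqP; rewrite pnatr_eq1; lia.
Qed.

Definition sqrt_poly K : {poly F} := \poly_(i < K) sqrt_coef i.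

(** The series [f = 2 sqrt (1 + x / 4)] satisfies [2 f' (x + 4) = f], so that
    [f^2] satisfies [(f^2)' (x + 4) = f^2], which determines its coefficients
    one after the other. *)
Lemma sqrt_polyM K i : (i < K)%N -> (sqrt_poly K * sqrt_poly K)`_i = ('X + 4%:R%:P)`_i.
Proof.
move=> iK; set p := sqrt_poly K.
have pE k : (k < K)%N -> p`_k = sqrt_coef k by move=> kK; rewrite coef_poly kK.
pose q := p^`() * ('X + 4%:R%:P) - 2^-1 *: p.
have q0 k : (k.+1 < K)%N -> q`_k = 0.
  move=> kK; rewrite /q coefB mulrDr coefD coefMC coefMX coefZ.
  have -> : (if k == 0%N then 0 else (p^`())`_k.-1) = sqrt_coef k *+ k.
    by case: k kK => [|k] kK; rewrite ?mulr0n //= coef_deriv pE // ltnW.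
  rewrite coef_deriv (pE k.+1) // (pE k) 1?ltnW //.
  rewrite -(mulr_natr (sqrt_coef k)) -(mulr_natr (sqrt_coef k.+1)).
  transitivity (sqrt_coef k.+1 * (4 * k.+1%:R) - sqrt_coef k * (2^-1 - k%:R));
    first by ring.
  by rewrite sqrt_coefS subrr.
have sqE : (p * p)^`() * ('X + 4%:R%:P) = p * p + p * q *+ 2.
  rewrite derivM /q -!mul_polyC.
  have h2 : (2^-1)%:P * 2%:R = 1 :> {poly F}.
    by rewrite -polyC_natr -polyCM mulVf ?pnatr_eq0.
  transitivity ((p^`() * p + p * p^`()) * ('X + 4%:P) - (2^-1)%:P * 2%:R * p * p + p * p).
    by rewrite h2; ring.
  by ring.
have rec k : (k.+1 < K)%N -> (p * p)`_k.+1 * (4 * k.+1%:R) = (p * p)`_k * (1 - k%:R).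
  move=> kK; have := congr1 (fun r : {poly F} => r`_k) sqE; rewrite /=.
  rewrite mulrDr !coefD coefMC coefMX.
  have -> : (if k == 0%N then 0 else ((p * p)^`())`_k.-1) = (p * p)`_k *+ k.
    by case: k {kK} => [|k]; rewrite ?mulr0n //= coef_deriv.
  have -> : (p * q)`_k = 0.
    rewrite coefM big1 // => l _; rewrite q0 ?mulr0 //.
    by apply: leq_ltn_trans kK; rewrite ltnS leq_subr.
  rewrite coef_deriv !addr0 -(mulr_natr _ k.+1) -(mulr_natr _ k) => h.
  by rewrite mulrBr mulr1 -{1}h; ring.
elim: i iK => [|i IH] iK.
  by rewrite coefM big_ord1 subnn pE // coefD coefX coefC add0r /= -natrM.
have n0 : (4 * i.+1%:R : F) != 0 by rewrite mulf_neq0 ?pnatr_eq0.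
apply: (mulIf n0); rewrite rec // IH 1?ltnW // !coefD !coefX !coefC /=.
case: i {IH iK n0} => [|[|i]] /=; rewrite ?eqxx /=; ring.
Qed.
End Sqrt.

(** * Functions on the lattice and on a box *)

Section Lattice.
Variables (F : numFieldType) (d : nat).
Notation Z := 'rV[int]_d.
(** The codomain is the regular module, which makes lattice functions a left
    module over [F]. *)
Definition fn := Z -> F^o.
HB.instance Definition _ := GRing.Lmodule.on fn.
Implicit Types (u v : fn) (x y a : Z).

Lemma fn_addE u v x : (u + v) x = u x + v x :> F. Proof. by []. Qed.
Lemma fn_oppE u x : (- u) x = - u x :> F. Proof. by []. Qed.
Lemma fn_scaleE (c : F) u x : (c *: u) x = c * u x :> F. Proof. by []. Qed.
Lemma fn_zeroE x : (0 : fn) x = 0 :> F. Proof. by []. Qed.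
Lemma fn_sumE (I : Type) (r : seq I) (P : pred I) (f : I -> fn) x :
  (\sum_(i <- r | P i) f i) x = \sum_(i <- r | P i) f i x :> F.
Proof. by elim/big_rec2: _ => // i y1 y2 _ <-. Qed.
Definition fnE := (fn_addE, fn_oppE, fn_scaleE, fn_zeroE, fn_sumE).

Definition bv (i : 'I_d) : Z := delta_mx 0 i.

Definition shift a v : fn := fun x => v (x + a).
Lemma shift_is_linear a : linear (shift a). Proof. by []. Qed.
HB.instance Definition _ a := GRing.isLinear.Build F fn fn _ (shift a) (shift_is_linear a).

Lemma shiftD a b v : shift a (shift b v) = shift (a + b) v.
Proof. by apply/funext => x; rewrite /shift addrA. Qed.
Lemma shiftC a b v : shift a (shift b v) = shift b (shift a v).
Proof. by rewrite !shiftD addrC. Qed.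
Lemma shift0 v : shift 0 v = v.
Proof. by apply/funext => x; rewrite /shift addr0. Qed.

Definition wd i v : fn := shift (bv i) v - shift (- bv i) v.
Definition ws i v : fn := shift (bv i) v + shift (- bv i) v.
Definition lap v : fn := \sum_i ws i v - (2 * d)%:R *: v.

Lemma wdE i v x : wd i v x = v (x + bv i) - v (x - bv i) :> F. Proof. by []. Qed.
Lemma wsE i v x : ws i v x = v (x + bv i) + v (x - bv i) :> F. Proof. by []. Qed.

Lemma wd_is_linear i : linear (wd i).
Proof. by move=> c v w; apply/funext => x; rewrite !(wdE, fnE); ring. Qed.
HB.instance Definition _ i := GRing.isLinear.Build F fn fn _ (wd i) (wd_is_linear i).
Lemma ws_is_linear i : linear (ws i).
Proof. by move=> c v w; apply/funext => x; rewrite !(wsE, fnE); ring. Qed.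
HB.instance Definition _ i := GRing.isLinear.Build F fn fn _ (ws i) (ws_is_linear i).

Lemma wd_shift i a v : wd i (shift a v) = shift a (wd i v).
Proof. by rewrite /wd !(shiftC _ a) -linearB. Qed.
Lemma ws_shift i a v : ws i (shift a v) = shift a (ws i v).
Proof. by rewrite /ws !(shiftC _ a) -linearD. Qed.
Lemma wdC i k v : wd i (wd k v) = wd k (wd i v).
Proof. by rewrite {2}/wd {3}/wd linearB /= !wd_shift. Qed.
Lemma wsC i k v : ws i (ws k v) = ws k (ws i v).
Proof. by rewrite {2}/ws {3}/ws linearD /= !ws_shift. Qed.
Lemma ws_wdC i k v : ws i (wd k v) = wd k (ws i v).
Proof. by rewrite /wd linearB /= !ws_shift. Qed.

Lemma ws_sq i v : ws i (ws i v) = wd i (wd i v) + 4%:R *: v.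
Proof.
apply/funext => x; rewrite !(wsE, wdE, fnE) !addrK !subrK; ring.
Qed.

Lemma lap_is_linear : linear (@lap).
Proof.
move=> c v w; rewrite /lap scalerBr scaler_sumr scalerDr scalerA.
rewrite opprD addrACA -big_split /=; congr (_ + _).
  by apply: eq_bigr => i _; rewrite linearP.
by rewrite scalerA mulrC.
Qed.
HB.instance Definition _ := GRing.isLinear.Build F fn fn _ lap lap_is_linear.

Lemma lap_wd i v : lap (wd i v) = wd i (lap v).
Proof.
have -> : wd i (lap v) = \sum_k wd i (ws k v) - (2 * d)%:R *: wd i v.
  by rewrite /lap (linearB (wd i)) (linear_sum (wd i)) (linearZ_LR (wd i)).
by congr (_ - _); apply: eq_bigr => k _; rewrite ws_wdC.
Qed.

Lemma lapE v x : lap v x = \sum_i (v (x + bv i) + v (x - bv i)) - (2 * d)%:R * v x :> F.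
Proof. by rewrite /lap !fnE. Qed.

End Lattice.

Section Box.
Variables (F : numFieldType) (d : nat).
Notation Z := 'rV[int]_d.
Notation fn := (fn F d).
Implicit Types (u v : fn) (x y a : Z).

Definition inQ m x := [forall i, `|x 0 i| <= m%:Z].

Lemma inQW m m' x : (m <= m')%N -> inQ m x -> inQ m' x.
Proof. by move=> mm /forallP h; apply/forallP => i; apply: le_trans (h i) _;
  rewrite lez_nat. Qed.

Lemma inQD m m' x y : inQ m x -> inQ m' y -> inQ (m + m') (x + y).
Proof.
move=> /forallP h /forallP h'; apply/forallP => i; rewrite mxE PoszD.
by apply: le_trans (ler_normD _ _) (lerD (h i) (h' i)).
Qed.

Lemma inQN m x : inQ m (- x) = inQ m x.
Proof. by apply: eq_forallb => i; rewrite mxE normrN. Qed.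

Lemma inQ_bv i : inQ 1 (bv i : Z).
Proof. by apply/forallP => k; rewrite mxE eqxx; case: eqP. Qed.

Lemma inQ0 m : inQ m 0.
Proof. by apply/forallP => i; rewrite mxE normr0. Qed.

Definition van m v := forall x, inQ m x -> v x = 0.

Lemma vanW m m' v : (m' <= m)%N -> van m v -> van m' v.
Proof. by move=> h vm x /(inQW h)/vm. Qed.

Lemma van_shift m k a v : inQ k a -> van (m + k) v -> van m (shift a v).
Proof. by move=> ak vm x xm; apply: vm; apply: inQD. Qed.

Lemma van_lin m c v w : van m v -> van m w -> van m (c *: v + w).
Proof. by move=> h h' x xm; rewrite !fnE h // h' // mulr0 addr0. Qed.

Lemma van0 m : van m 0. Proof. by []. Qed.

Lemma van_sum (I : Type) (r : seq I) (P : pred I) m (f : I -> fn) :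
  (forall i, P i -> van m (f i)) -> van m (\sum_(i <- r | P i) f i).
Proof. by move=> h x xm; rewrite fnE big1 // => i Pi; rewrite h. Qed.

Lemma van_wd m i v : van m.+1 v -> van m (wd i v).
Proof.
rewrite -addn1 => h x xm; rewrite wdE.
by rewrite !h ?subr0 //; apply: inQD; rewrite ?inQN ?inQ_bv.
Qed.

Lemma van_lap m v : van m.+1 v -> van m (lap v).
Proof.
rewrite -addn1 => h x xm; rewrite lapE big1 => [|i _].
  by rewrite h ?mulr0 ?subr0 //; apply: inQW xm; rewrite leq_addr.
by rewrite !h ?addr0 //; apply: inQD; rewrite ?inQN ?inQ_bv.
Qed.

Lemma van_iter_lap k m v : van (m + k) v -> van m (iter k (@lap F d) v).
Proof.
elim: k m => [|k IH] m; first by rewrite addn0.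
by rewrite addnS -addSn => /IH; apply: van_lap.
Qed.

Variable n : nat.
Definition box := 'rV['I_(n.*2).+1]_d.
Definition pt (b : box) : Z := \row_i ((b 0 i : nat)%:Z - n%:Z).
Definition bfun := {ffun box -> F^o}.
HB.instance Definition _ := Vector.on bfun.
Implicit Types (b : box) (phi : bfun).

Lemma pt_inj : injective pt.
Proof.
move=> b b' /rowP h; apply/rowP => i; apply: val_inj; have := h i; rewrite !mxE.
by move/(addIr _) => [].
Qed.

Lemma inQ_pt b : inQ n (pt b).
Proof. by apply/forallP => i; rewrite mxE; have := ltn_ord (b 0 i); lia. Qed.

Lemma ptP x : inQ n x -> exists b, pt b = x.
Proof.
move=> /forallP xn; have h i : (absz (x 0%R i + n%:Z)%R < (n.*2).+1)%N by have := xn i; lia.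
exists (\row_i Ordinal (h i)); apply/rowP => i; rewrite !mxE /=.
by have := xn i; lia.
Qed.

Definition restr m v : bfun := [ffun b => if inQ m (pt b) then v (pt b) else 0].
Lemma restr_is_linear m : linear (restr m).
Proof.
move=> c v w; apply/ffunP => b; rewrite !ffunE fnE; case: ifP => // _.
by rewrite [c *: _]mulr0 addr0.
Qed.
HB.instance Definition _ m := GRing.isLinear.Build F fn bfun _ (restr m) (restr_is_linear
  m).

Lemma restr_eq0 m v : (m <= n)%N -> restr m v = 0 <-> van m v.
Proof.
move=> mn; split=> [h x xm|h]; last first.
  by apply/ffunP => b; rewrite !ffunE; case: ifP => // /h.
have [b bx] := ptP (inQW mn xm); have /ffunP/(_ b) := h.
by rewrite !ffunE bx xm.
Qed.

(** A linear section of restriction, through which operators on lattice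
    functions act on functions on the box. *)
Definition ext phi : fn := \sum_b phi b *: (fun x => (pt b == x)%:R : F^o).
Lemma ext_is_linear : linear ext.
Proof.
move=> c f g; rewrite /ext scaler_sumr -big_split /=; apply: eq_bigr => b _.
by rewrite !ffunE scalerDl scalerA.
Qed.
HB.instance Definition _ := GRing.isLinear.Build F bfun fn _ ext ext_is_linear.

Lemma extE phi b : ext phi (pt b) = phi b.
Proof.
rewrite /ext fnE (bigD1 b) //= big1 => [|c cb]; rewrite fnE.
  by rewrite eqxx mulr1 addr0.
by rewrite (inj_eq pt_inj) (negbTE cb) mulr0.
Qed.

Lemma ext_restr m v : (m <= n)%N -> van m (ext (restr m v) - v).
Proof.
move=> mn x xm; have [b bx] := ptP (inQW mn xm).
by rewrite !fnE -bx extE ffunE bx xm subrr.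
Qed.

(** What [v] does outside the larger box has no influence on [f v] inside the
    smaller one. *)
Lemma restr_local (f : {linear fn -> fn}) m m' v : (m <= n)%N -> (m' <= n)%N ->
  (forall w, van m w -> van m' (f w)) ->
  restr m' (f (ext (restr m v))) = restr m' (f v).
Proof.
move=> mn mn' h; apply/eqP; rewrite -subr_eq0 -linearB -linearB /=; apply/eqP.
by apply/restr_eq0 => //; apply/h/ext_restr.
Qed.
End Box.

Section Support.
Variables (F : numFieldType) (d n : nat) (u : fn F d).
Notation box := (box d n).
Notation bfun := (bfun F d n).

Definition supp_box : {set box} := [set b | u (pt b) != 0].

(** Such functions are combinations of the point masses of [S]. *)
Lemma dim_supp (W : {vspace bfun}) (S : {set box}) :
  (forall phi, phi \in W -> forall b, b \notin S -> phi b = 0) -> (\dim W <= #|S|)%N.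
Proof.
move=> h; pose dl (b : box) : bfun := [ffun b' => (b' == b)%:R].
have sW : (W <= <<[seq dl b | b <- enum S]>>)%VS.
  apply/subvP => phi /h phi0.
  have -> : phi = \sum_b phi b *: dl b.
    apply/ffunP => b; rewrite sum_ffunE (bigD1 b) //= big1 => [|c cb].
      by rewrite !ffunE eqxx addr0 [_ *: _]mulr1.
    by rewrite !ffunE eq_sym (negbTE cb) [_ *: _]mulr0.
  apply: rpred_sum => b _; have [bS|/phi0->] := boolP (b \in S);
    last by rewrite scale0r rpred0.
  by apply/rpredZ/memv_span/map_f; rewrite mem_enum.
apply: leq_trans (dimvS sW) _; apply: leq_trans (dim_span _) _.
by rewrite size_map -cardE.
Qed.

End Support.

Section Determining.
Variables (F : fieldType) (T : finType).
Implicit Type W : {vspace {ffun T -> F^o}}.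

(** Evaluation at a point where some member of [W] is nonzero cuts out a
    subspace of dimension one less. *)
Lemma determining_set W : exists E : {set T}, (#|E| <= \dim W)%N /\
  forall phi, phi \in W -> (forall b, b \in E -> phi b = 0) -> phi = 0.
Proof.
elim: {W}(\dim W) {-2}W (erefl (\dim W)) => [|k IH] W dW.
  exists (finset.set0 : {set T}); rewrite cards0; split=> // phi;
    rewrite (eqP (_ : W == 0%VS)) -?dimv_eq0 ?dW //.
  by rewrite memv0 => /eqP.
have W0 : W != 0%VS by rewrite -dimv_eq0 dW.
have [b /eqP pb] : exists b, vpick W b != 0.
  apply/existsP; apply: contraNT W0 => /existsPn h.
  rewrite -vpick0; apply/eqP/ffunP => b; rewrite ffunE; apply/eqP.
  by have := h b; rewrite negbK.
have evl : linear (fun phi : {ffun T -> F^o} => phi b : F^o) by move=> a v w;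
  rewrite !ffunE.
pose evb : {linear {ffun T -> F^o} -> F^o} :=
  HB.pack (fun phi : {ffun T -> F^o} => phi b : F^o) (GRing.isLinear.Build _ _ _ _ _ evl).
pose f := linfun evb; pose W' := (W :&: lker f)%VS.
have dW' : \dim W' = k.
  have := limg_ker_dim f W; rewrite dW -/W'.
  have -> : \dim (f @: W) = 1%N; last by rewrite addn1 => -[].
  apply/eqP; rewrite eqn_leq; apply/andP; split.
    by apply: leq_trans (dimvS (subvf _)) _; rewrite dimvf.
  rewrite lt0n dimv_eq0; apply/eqP => h; apply: pb.
  have := memv_img f (memv_pick W); rewrite h memv0 lfunE /= => /eqP; exact.
have [E [cE hE]] := IH W' dW'.
exists (b |: E); split.
  by rewrite dW (leq_trans (leq_card_setU _ _)) // cards1 add1n ltnS -dW'.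
move=> phi phiW h; apply: hE => [|c cE']; last by apply: h; rewrite inE cE' orbT.
rewrite memv_cap phiW memv_ker lfunE; apply/eqP; apply: h; exact: finset.setU11.
Qed.
End Determining.

Module PolynomialMethod.
Import mpoly ssrcomplements.

(** * Truncated polynomial rings *)

Section Order.
Variables (F : fieldType) (d : nat).
Implicit Types (p q : {mpoly F[d]}) (m : 'X_{1..d}).

(** Membership in the [e]-th power of the maximal ideal of the origin. *)
Definition ordge e p := forall m, (mdeg m < e)%N -> p@_m = 0.

Lemma ordge_zero e : ordge e 0. Proof. by move=> m _; rewrite mcoeff0. Qed.

Lemma ordgeW e e' p : (e' <= e)%N -> ordge e p -> ordge e' p.
Proof. by move=> h pe m me; apply: pe; apply: leq_trans h. Qed.

Lemma ordgeD e p q : ordge e p -> ordge e q -> ordge e (p + q).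
Proof. by move=> h1 h2 m me; rewrite mcoeffD h1 // h2 // addr0. Qed.

Lemma ordgeN e p : ordge e p -> ordge e (- p).
Proof. by move=> h1 m me; rewrite mcoeffN h1 // oppr0. Qed.

Lemma ordgeB e p q : ordge e p -> ordge e q -> ordge e (p - q).
Proof. by move=> h1 h2; apply/ordgeD/ordgeN. Qed.

Lemma ordgeZ e c p : ordge e p -> ordge e (c *: p).
Proof. by move=> h m me; rewrite mcoeffZ h // mulr0. Qed.

Lemma ordge_sum (I : Type) (r : seq I) (P : pred I) e (f : I -> {mpoly F[d]}) :
  (forall i, P i -> ordge e (f i)) -> ordge e (\sum_(i <- r | P i) f i).
Proof.
move=> h; apply: (big_ind (ordge e)) => //; first exact: ordge_zero.
exact: ordgeD.
Qed.

Lemma ordgeM e e' p q : ordge e p -> ordge e' q -> ordge (e + e') (p * q).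
Proof.
move=> hp hq m me; rewrite mcoeffM big1 // => -[k1 k2] /= /eqP mE.
have := mdegD k1 k2; rewrite -mE => dE.
have [h|h] := ltnP (mdeg k1) e; first by rewrite hp // mul0r.
by rewrite [q@__]hq ?mulr0 //; lia.
Qed.

Lemma ordgeMl e p q : ordge e q -> ordge e (p * q).
Proof. by move=> h; rewrite -[e]add0n; apply: ordgeM. Qed.

Lemma ordgeMr e p q : ordge e p -> ordge e (p * q).
Proof. by move=> h; rewrite mulrC; apply: ordgeMl. Qed.

Lemma ordgeX e p n : ordge e p -> ordge (n * e) (p ^+ n).
Proof. by move=> h; elim: n => [|n IH] //; rewrite exprS mulSn; apply: ordgeM. Qed.

Lemma ordge_monom m : ordge (mdeg m) 'X_[m].
Proof. by move=> m' h; rewrite mcoeffX; case: eqP h => // ->; rewrite ltnn. Qed.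

Lemma ordge_var (i : 'I_d) n : ordge n ('X_i ^+ n : {mpoly F[d]}).
Proof.
by rewrite -[n in ordge n]muln1; apply: ordgeX; rewrite -[1%N](mdeg1 i); apply: ordge_monom.
Qed.

Lemma ordge1P p : p@_0%MM = 0 -> ordge 1 p.
Proof. by move=> h m; rewrite ltnS leqn0 mdeg_eq0 => /eqP ->. Qed.

(** The geometric series inverts a polynomial with nonzero constant term up to
    high order. *)
Lemma ordge_inv e p : p@_0%MM != 0 -> exists q, ordge e (1 - p * q).
Proof.
set c := p@_0%MM => c0; pose n := 1 - c^-1 *: p.
exists (c^-1 *: \sum_(i < e) n ^+ i).
have n1 : ordge 1 n.
  by apply: ordge1P; rewrite mcoeffB mcoeffZ mcoeff1 eqxx mulVf ?subrr.
have -> : 1 - p * (c^-1 *: \sum_(i < e) n ^+ i) = n ^+ e.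
  rewrite -scalerAr scalerAl; have ->
    : c^-1 *: p = - (n - 1) by rewrite /n opprB opprB addrC subrK.
  by rewrite mulNr -subrX1; ring.
by rewrite -[e in ordge e]muln1; apply: ordgeX.
Qed.
End Order.

Section Trunc.
Variables (F : fieldType) (d j : nat).
Implicit Types (p q f : {mpoly F[d]}) (m : 'X_{1..d}).

(** The polynomial ring modulo order [j.+1], as a space of coefficient
    vectors. *)
Definition tpoly := {ffun 'X_{1..d < j.+1} -> F^o}.
HB.instance Definition _ := Vector.on tpoly.

Definition tr p : tpoly := [ffun m => p@_(bmnm m)].
Definition emb (v : tpoly) : {mpoly F[d]} := \sum_(m : 'X_{1..d < j.+1}) v m *: 'X_[m].

Lemma mcoeff_emb v (m : 'X_{1..d < j.+1}) : (emb v)@_m = v m.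
Proof.
rewrite /emb raddf_sum (bigD1 m) //= big1 => [|k km].
  by rewrite mcoeffZ mcoeffX eqxx mulr1 addr0.
by rewrite mcoeffZ mcoeffX -bmeqP (negbTE km) mulr0.
Qed.

Lemma mcoeff_emb_high v m : (j < mdeg m)%N -> (emb v)@_m = 0.
Proof.
move=> jm; rewrite /emb raddf_sum big1 // => k _ /=.
rewrite mcoeffZ mcoeffX; case: eqP jm => [<-|]; last by rewrite mulr0.
by rewrite ltnNge -ltnS bmdeg.
Qed.

Lemma trK v : tr (emb v) = v.
Proof. by apply/ffunP => m; rewrite ffunE mcoeff_emb. Qed.

Lemma tr_is_linear : linear tr.
Proof. by move=> a p q; apply/ffunP => m; rewrite !ffunE mcoeffD mcoeffZ. Qed.
HB.instance Definition _ := GRing.isLinear.Build F {mpoly F[d]} tpoly _ tr tr_is_linear.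

Lemma emb_is_linear : linear emb.
Proof.
move=> a v w; rewrite /emb scaler_sumr -big_split /=; apply: eq_bigr => m _.
by rewrite !ffunE scalerDl scalerA.
Qed.
HB.instance Definition _ := GRing.isLinear.Build F tpoly {mpoly F[d]} _ emb emb_is_linear.

Lemma tr_eq0 p : tr p = 0 <-> ordge j.+1 p.
Proof.
split=> [h m mj|h]; last by apply/ffunP => m; rewrite !ffunE h // bmdeg.
by have /ffunP/(_ (BMultinom mj)) := h; rewrite !ffunE.
Qed.

Lemma emb_tr p : ordge j.+1 (p - emb (tr p)).
Proof. by apply/tr_eq0; rewrite linearB /= trK subrr. Qed.

Lemma tr_eq p q : ordge j.+1 (p - q) -> tr p = tr q.
Proof. by move=> /tr_eq0; rewrite linearB /= => /eqP; rewrite subr_eq0 => /eqP. Qed.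

Definition tmul_fun f (v : tpoly) : tpoly := tr (f * emb v).

Lemma tmul_fun_is_linear f : linear (tmul_fun f).
Proof. by move=> a v w; rewrite /tmul_fun linearP mulrDr -scalerAr linearP. Qed.
HB.instance Definition _ f := GRing.isLinear.Build F tpoly tpoly _ (tmul_fun f)
  (tmul_fun_is_linear f).

Definition tmul f : 'End(tpoly) := linfun (tmul_fun f).

Lemma tmul_tr f p : tmul f (tr p) = tr (f * p).
Proof.
rewrite lfunE /= /tmul_fun; apply: tr_eq; rewrite -mulrBr; apply: ordgeMl.
by rewrite -opprB; apply/ordgeN/emb_tr.
Qed.

Lemma tmul_comp f g : (tmul f \o tmul g)%VF = tmul (f * g).
Proof. by apply/lfunP => v; rewrite -[v]trK comp_lfunE !tmul_tr mulrA. Qed.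

Lemma tmul_comm f g : (tmul f \o tmul g = tmul g \o tmul f)%VF.
Proof. by rewrite !tmul_comp mulrC. Qed.

Lemma mem_limg_tmul f v : reflect (exists p, v = tr (f * p)) (v \in limg (tmul f)).
Proof.
apply: (iffP memv_imgP) => [[w _ ->]|[p ->]].
  by exists (emb w); rewrite -tmul_tr trK.
by exists (tr p); rewrite ?memvf // tmul_tr.
Qed.
End Trunc.

(** * Dilates of the square root series *)

Section PowerSums.
Variables (F : numFieldType) (d : nat).
Implicit Types (p q f : {mpoly F[d]}).

Definition psum k : {mpoly F[d]} := \sum_(i < d) 'X_i ^+ (2 * k).

(** The series [sum_i (2 sqrt (1 + y_i^2 / 4) - 2)] dilated by [s] and
    truncated, written with power sums of the [y_i^2]. *)
Definition sqrt_series K (s : F) : {mpoly F[d]} :=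
  \sum_(1 <= k < K) (sqrt_coef F k * s ^+ (2 * k)) *: psum k.

Let sqs : seq {mpoly F[d]} := [seq 'X_i ^+ 2 | i <- enum 'I_d].
Let E := rootpoly sqs.

Let size_sqs : size sqs = d. Proof. by rewrite size_map size_enum_ord. Qed.
Let nth_sqs (i : 'I_d) : sqs`_i = 'X_i ^+ 2.
Proof. by rewrite (nth_map i) ?size_enum_ord // nth_ord_enum. Qed.

Let sum_sqs k : \sum_(i < d) sqs`_i ^+ k = psum k.
Proof.
rewrite /psum; apply: eq_bigr => i _.
by rewrite nth_sqs exprM.
Qed.

Let rootE (i : 'I_d) : 'X_i ^+ (2 * d) = - \sum_(k < d) E`_k * 'X_i ^+ (2 * k).
Proof.
have := @rootpolyX _ sqs i; rewrite size_sqs => /(_ (ltn_ord i)).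
rewrite nth_sqs -exprM => ->; congr (- _); apply: eq_bigr => k _.
by rewrite exprM.
Qed.

Let E_ordge k : (k < d)%N -> ordge 1 (E`_k).
Proof.
move=> kd; apply: ordge1P.
have -> : (E`_k)@_0%MM = (map_poly (mcoeff 0%MM) E)`_k by rewrite coef_map.
have -> : map_poly (mcoeff 0%MM) E = 'X^d.
  rewrite /E /rootpoly rmorph_prod /= big_map big_enum /=.
  rewrite (eq_bigr (fun=> 'X)) ?prodr_const ?card_ord // => i _.
  rewrite rmorphB /= map_polyX map_polyC /=.
  by rewrite mpolyXn mcoeffX -mdeg_eq0 mdegMn mdeg1 ?subr0.
by rewrite coefXn; case: eqP kd => // ->; rewrite ltnn.
Qed.

(** Each [y_i^2] is a root of the polynomial with coefficients [E]. *)
Let psum_rec m : (d < m)%N -> psum m = - \sum_(k < d) E`_k * psum (m - d + k).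
Proof.
move=> dm; rewrite /psum.
rewrite (eq_bigr (fun i : 'I_d => - \sum_(k < d) E`_k * 'X_i ^+ (2 * (m - d + k)))).
  rewrite sumrN exchange_big /=; congr (- _); apply: eq_bigr => k _.
  by rewrite mulr_sumr.
move=> i _; have -> : (2 * m = 2 * (m - d) + 2 * d)%N by lia.
rewrite exprD rootE mulrN mulr_sumr; congr (- _); apply: eq_bigr => k _.
by rewrite mulrCA -exprD mulnDr.
Qed.

(* The predicate mem below is the ideal U pulled back to polynomials. *)
Variables (j K : nat) (U : {vspace tpoly F d j}).
Hypothesis U_ideal : forall f, (tmul j f @: U <= U)%VS.
Hypothesis jK : (j + d < K)%N.

Let mem p := tr j p \in U.
Let memM f p : mem p -> mem (f * p).
Proof.
by move=> pU; rewrite /mem -tmul_tr; apply: (subvP (U_ideal f)); apply: memv_img.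
Qed.
Let memD p q : mem p -> mem q -> mem (p + q).
Proof. by rewrite /mem linearD /=; apply: rpredD. Qed.
Let memZ c p : mem p -> mem (c *: p).
Proof. by rewrite /mem linearZ /=; apply: rpredZ. Qed.
Let memN p : mem p -> mem (- p).
Proof. by rewrite /mem linearN /=; rewrite rpredN. Qed.
Let mem_sum (I : Type) (r : seq I) (P : pred I) (f : I -> {mpoly F[d]}) :
  (forall i, P i -> mem (f i)) -> mem (\sum_(i <- r | P i) f i).
Proof. by move=> h; rewrite /mem linear_sum; apply: rpred_sum. Qed.
Let mem_ord p : ordge j.+1 p -> mem p.
Proof. by move=> /tr_eq0; rewrite /mem => ->; rewrite rpred0. Qed.

Variable s : 'I_d -> F.
Hypothesis s_neq0 : forall l, s l != 0.
Hypothesis s_inj : injective (fun l => s l ^+ 2).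
Hypothesis s_mem : forall l, mem (sqrt_series K (s l)).

(** The [s l ^+ 2] are distinct and nonzero, so that the Vandermonde system
    has a solution for every right-hand side. *)
Lemma vandermonde_dual (k : 'I_d) : exists lam : 'I_d -> F,
  forall k' : 'I_d, \sum_l lam l * s l ^+ (2 * k'.+1) = (k' == k)%:R.
Proof.
pose a : 'rV[F]_d := \row_l s l ^+ 2.
pose M := Vandermonde d a *m diag_mx a.
have Mu : M \in unitmx.
  rewrite unitmx_mul !unitmxE det_Vandermonde det_diag.
  apply/andP; split; rewrite unitfE; apply/prodf_neq0 => i _.
    apply/prodf_neq0 => i' ii'; rewrite !mxE subr_eq0; apply: contraTneq ii' => /s_inj ->.
    by rewrite ltnn.
  by rewrite mxE expf_neq0.
exists (fun l => (invmx M) l k) => k'.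
have := congr1 (fun N : 'M[F]_d => N k' k) (mulmxV Mu); rewrite [LHS]mxE [RHS]mxE => <-.
apply: eq_bigr => l _; rewrite mulrC; congr (_ * _).
by rewrite /M mul_mx_diag !mxE -exprSr -exprM.
Qed.

(** A combination of the dilates in which, by the choice of the weights, only
    one of the first [d] power sums survives. *)
Let psum_head k : (0 < k <= d)%N -> exists g : nat -> F,
  mem (psum k + \sum_(d.+1 <= m < K) g m *: psum m).
Proof.
move=> /andP[k0 kd]; have kd' : (k.-1 < d)%N by lia.
have [lam lamP] := vandermonde_dual (Ordinal kd').
pose c := sqrt_coef F k.
exists (fun m => c^-1 * \sum_l lam l * (sqrt_coef F m * s l ^+ (2 * m))).
suff -> : psum k + \sum_(d.+1 <= m < K) (c^-1 * \sum_l lam l * (sqrt_coef F m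
  * s l ^+ (2 * m))) *: psum m
    = c^-1 *: \sum_l lam l *: sqrt_series K (s l).
  by apply/memZ/mem_sum => l _; apply/memZ/s_mem.
have -> : \sum_l lam l *: sqrt_series K (s l)
    = \sum_(1 <= m < K) (\sum_l lam l * (sqrt_coef F m * s l ^+ (2 * m))) *: psum m.
  rewrite /sqrt_series; under eq_bigr do rewrite scaler_sumr.
  rewrite exchange_big /=; apply: eq_bigr => m _.
  by rewrite scaler_suml; apply: eq_bigr => l _; rewrite scalerA.
rewrite [in RHS](big_cat_nat (n := d.+1)) //=; last by lia.
rewrite scalerDr; congr (_ + _); last first.
  by rewrite scaler_sumr; apply: eq_bigr => m _; rewrite scalerA.
have E1 m : (0 < m <= d)%N -> \sum_l lam l * (sqrt_coef F m * s l ^+ (2 * m)) =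
  sqrt_coef F m * (m == k)%:R.
  move=> md; have md' : (m.-1 < d)%N by lia.
  have := lamP (Ordinal md'); rewrite /= prednK; last by lia.
  rewrite -val_eqE /= => h; have -> : (m == k) = (m.-1 == k.-1) by lia.
  by rewrite -h mulr_sumr; apply: eq_bigr => l _; rewrite mulrCA.
rewrite (big_cat_nat _ (n := k)) //=; last by lia.
rewrite big_nat big1 => [|m mk]; last first.
  by rewrite E1; [rewrite (_ : m == k = false) ?mulr0 ?scale0r //; lia|lia].
rewrite add0r big_ltn; last by lia.
rewrite E1; last by lia.
rewrite eqxx mulr1 big_nat big1 => [|m mk]; last first.
  by rewrite E1; [rewrite (_ : m == k = false) ?mulr0 ?scale0r //; lia|lia].
by rewrite addr0 scalerA mulVf ?sqrt_coef_neq0 // scale1r.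
Qed.

(** Descending induction on [e]: the power sums of order larger than [d] are
    combinations of those of order at most [d] whose coefficients have
    positive order. *)
Let psum_mem e f k : ordge e f -> (0 < k <= d)%N -> mem (f * psum k).
Proof.
have [n] := ubnP (j.+1 - e)%N; elim: n e f k => // n IH e f k en fe kd.
have [je|ej] := leqP j.+1 e; first by apply/mem_ord/ordgeMr/(ordgeW je fe).
have tail m g : (d < m)%N -> ordge e g -> mem (g * psum m).
  have [n'] := ubnP m; elim: n' m g => // n' IHm m g mn dm ge.
  rewrite psum_rec // mulrN mulr_sumr; apply/memN/mem_sum => l _.
  have El : ordge e.+1 (g * E`_l) by rewrite -addn1; apply: ordgeM => //; apply: E_ordge.
  rewrite mulrA; have [h|h] := leqP (m - d + l)%N d.
    by apply: (IH e.+1) => //; lia.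
  apply: IHm => //; first by have := ltn_ord l; lia.
  by apply: ordgeW El.
have [g gP] := psum_head kd.
have -> : psum k = (psum k + \sum_(d.+1 <= m < K) g m *: psum m)
                    - \sum_(d.+1 <= m < K) g m *: psum m by rewrite addrK.
rewrite mulrBr; apply: memD; first exact: memM.
apply: memN; rewrite mulr_sumr big_nat; apply: mem_sum => m /andP[dm _].
by rewrite -scalerAr; apply/memZ/tail.
Qed.

(** Newton's identities express a multiple of [E`_k] through later
    coefficients and power sums. *)
Let E_mem k : (k < d)%N -> mem (E`_k).
Proof.
have [n] := ubnP (d - k)%N; elim: n k => // n IH k kn kd.
have := @newton _ sqs k; rewrite size_sqs => /(_ (ltnW kd)).
under eq_bigr do rewrite sum_sqs.
move=> h; have {}h : (d - k)%:R *: E`_k =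
    - \sum_(k <= l < d) E`_l.+1 * psum (l.+1 - k).
  apply/eqP; rewrite -subr_eq0 opprK scaler_nat mulrnBr ?(ltnW kd) //.
  by rewrite addrAC -h subrr.
have : mem ((d - k)%:R *: E`_k).
  rewrite h; apply: memN; rewrite big_nat; apply: mem_sum => l /andP[kl ld].
  by apply: (@psum_mem 0) => //; lia.
move/(memZ ((d - k)%:R)^-1); rewrite scalerA mulVf ?scale1r //.
by rewrite pnatr_eq0; lia.
Qed.

Lemma pow_mem (i : 'I_d) : mem ('X_i ^+ (2 * d)).
Proof.
rewrite rootE; apply/memN/mem_sum => k _; rewrite mulrC; apply/memM/E_mem.
exact: ltn_ord.
Qed.

(** An ideal that contains [d] dilates by scalars with distinct squares
    contains the power sums of the [y_i^2], first those of order at most [d]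
    up to higher ones ([psum_head]), then all of them exactly ([psum_mem]). By
    Newton's identities it contains the elementary symmetric functions, hence
    every [y_i ^ (2 d)], and there are [(2 d) ^ d] monomials left. *)
Lemma codim_sqrt_series : (codim U <= (2 * d) ^ d)%N.
Proof.
pose mon (a : {ffun 'I_d -> 'I_(2 * d)}) : {mpoly F[d]} :=
  'X_[[multinom (a i : nat) | i < d]].
pose W := <<[seq tr j (mon a) | a <- enum {ffun 'I_d -> 'I_(2 * d)}]>>%VS.
have WU : (fullv <= U + W)%VS.
  apply/subvP => v _; rewrite -[v]trK /emb linear_sum; apply: rpred_sum => m _.
  rewrite linearZ /=; apply: rpredZ.
  have [/existsP [i hi]|] := boolP [exists i : 'I_d, (2 * d <= bmnm m i)%N].
    apply: (subvP (addvSl _ _)).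
    have -> : 'X_[m] = 'X_[m - U_(i) *+ (2 * d)] * 'X_i ^+ (2 * d) :> {mpoly F[d]}.
      rewrite mpolyXn -mpolyXD submK //; apply/mnm_lepP => l.
      by rewrite mulmnE mnm1E; case: eqP => [<-|]; rewrite ?mul1n ?mul0n.
    exact/memM/pow_mem.
  rewrite negb_exists => /forallP h; apply: (subvP (addvSr _ _)).
  have hl l : (bmnm m l < 2 * d)%N by rewrite ltnNge h.
  apply: memv_span; apply/mapP; exists [ffun l => Ordinal (hl l)];
    first by rewrite mem_enum.
  by congr (tr j _); congr 'X_[_]; apply/mnmP => l; rewrite mnmE ffunE.
have dW : (\dim W <= (2 * d) ^ d)%N.
  by apply: leq_trans (dim_span _) _; rewrite size_map -cardE card_ffun !card_ord.
rewrite /codim leq_subLR; apply: leq_trans (dimvS WU) _.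
by apply: leq_trans (dimv_add_leqif U W) _; rewrite leq_add2l.
Qed.
End PowerSums.

(** * The norm of the Laplacian *)

Section Congruence.
Variables (F : fieldType) (d : nat) (e : nat).
Implicit Types (p q : {mpoly F[d]}).

Lemma ordge_congM p p' q q' :
  ordge e (p - p') -> ordge e (q - q') -> ordge e (p * q - p' * q').
Proof.
move=> hp hq; have -> : p * q - p' * q' = p * (q - q') + (p - p') * q' by ring.
by apply: ordgeD; [apply: ordgeMl|apply: ordgeMr].
Qed.

Lemma ordge_comp n (r : {mpoly F[n]}) (a b : n.-tuple {mpoly F[d]}) :
  (forall i, ordge e (tnth a i - tnth b i)) -> ordge e ((r \mPo a) - (r \mPo b)).
Proof.
move=> h; rewrite !comp_mpolyEX -sumrB; apply: ordge_sum => m _.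
rewrite -scalerBr; apply: ordgeZ; rewrite !comp_mpolyX.
apply: (big_ind2 (fun x y => ordge e (x - y))).
- by rewrite subrr; apply: ordge_zero.
- by move=> *; apply: ordge_congM.
move=> i _; elim: (m i) => [|k IH]; first by rewrite subrr; apply: ordge_zero.
by rewrite !exprS; apply: ordge_congM.
Qed.
End Congruence.

Section Norm.
Variables (F : numFieldType) (d : nat).
Implicit Types (p q : {mpoly F[d]}) (sg : {ffun 'I_d -> bool}).

Definition lform sg : {mpoly F[d]} := \sum_i (-1) ^+ sg i *: 'X_i - (2 * d)%:R.
(** The norm of [sum_i t_i - 2d] over the sign changes of the variables, which
    makes it a polynomial in the [t_i^2]. *)
Definition normpoly : {mpoly F[d]} := \prod_sg lform sg.
(** The polynomial that takes the value [normpoly] at the squares of the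
    variables. *)
Definition sq_half : {mpoly F[d]} :=
  \sum_(m <- msupp normpoly) normpoly@_m *: 'X_[[multinom (m i)./2 | i < d]].
(** If [t_i = T_i + T_i^-1] and [w_i = T_i - T_i^-1] then [t_i^2 = w_i^2 + 4],
    so that this is the norm as a polynomial in the [w_i]. *)
Definition relpoly : {mpoly F[d]} := sq_half \mPo [tuple 'X_i ^+ 2 + 4%:R | i < d].

Let flip (i : 'I_d) : d.-tuple {mpoly F[d]} := [tuple (-1) ^+ (l == i) *: 'X_l | l < d].

Let normpoly_flip i : normpoly \mPo flip i = normpoly.
Proof.
rewrite /normpoly rmorph_prod /=.
pose fl sg := [ffun l => sg l (+) (l == i)] : {ffun 'I_d -> bool}.
have flK : involutive fl by move=> sg; apply/ffunP => l; rewrite !ffunE addbK.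
rewrite [RHS](reindex_inj (inv_inj flK)) /=; apply: eq_bigr => sg _.
rewrite /lform comp_mpolyB raddf_sum /=; congr (_ - _); last first.
  by rewrite rmorph_nat.
apply: eq_bigr => l _; rewrite comp_mpolyZ comp_mpolyXU -tnth_nth tnth_mktuple.
by rewrite ffunE scalerA signr_addb.
Qed.

(** The coefficient of a monomial odd in [t_i] equals its own opposite, by the
    invariance under [t_i -> - t_i]. *)
Let normpoly_even m i : m \in msupp normpoly -> ~~ odd (m i).
Proof.
rewrite mcoeff_msupp; apply: contraNN => oi.
have : normpoly@_m = (-1) ^+ (m i) * normpoly@_m.
  rewrite -{1}(normpoly_flip i) comp_mpolyEX raddf_sum /=.
  have E m' : 'X_[m'] \mPo flip i = (-1) ^+ (m' i) *: 'X_[m'].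
    rewrite comp_mpolyX [in RHS]mpolyXE_id (bigD1 i) //= [in RHS](bigD1 i) //=.
    rewrite tnth_mktuple eqxx exprZn scalerAl; congr (_ * _).
    by apply: eq_bigr => l li; rewrite tnth_mktuple (negbTE li) expr0 scale1r.
  have [mn|mn] := boolP (m \in msupp normpoly); last first.
    rewrite (memN_msupp_eq0 mn) mulr0 big_seq big1 // => m' m'n.
    rewrite E !mcoeffZ mcoeffX; case: eqP m'n mn => [->->//|]; first by rewrite !mulr0.
  rewrite (bigD1_seq m) ?msupp_uniq //= big1 => [|m' m'm].
    by rewrite E !mcoeffZ mcoeffX eqxx mulr1 addr0 mulrC.
  by rewrite E !mcoeffZ mcoeffX (negbTE m'm) !mulr0.
rewrite -signr_odd oi expr1 mulN1r => /eqP; rewrite -subr_eq0 opprK -mulr2n.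
by rewrite mulrn_eq0.
Qed.

Lemma sq_halfE (a : d.-tuple {mpoly F[d]}) :
  sq_half \mPo [tuple tnth a i ^+ 2 | i < d] = normpoly \mPo a.
Proof.
rewrite /sq_half raddf_sum /= [RHS]comp_mpolyEX big_seq [RHS]big_seq.
apply: eq_bigr => m mn; rewrite comp_mpolyZ !comp_mpolyX; congr (_ *: _).
apply: eq_bigr => i _; rewrite tnth_mktuple mnmE -exprM mul2n.
by rewrite -{2}[m i]odd_double_half (negbTE (normpoly_even _ _)).
Qed.

Lemma sq_half_sq : exists q,
  sq_half \mPo [tuple 'X_i ^+ 2 | i < d] = q * (\sum_i 'X_i - (2 * d)%:R).
Proof.
exists (\prod_(sg | sg != [ffun=> false]) lform sg).
have -> : \sum_i 'X_i - (2 * d)%:R = lform [ffun=> false].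
  by congr (_ - _); apply: eq_bigr => i _; rewrite ffunE expr0 scale1r.
have <- : normpoly = (\prod_(sg | sg != [ffun=> false]) lform sg) * lform [ffun=> false].
  by rewrite /normpoly (bigD1 [ffun=> false]) //= mulrC.
rewrite -[RHS]comp_mpoly_id -sq_halfE; congr (_ \mPo _).
by apply: eq_from_tnth => i; rewrite !tnth_mktuple.
Qed.

(** Near the origin [t_i = sqrt (y_i^2 + 4)] is a power series. Of the factors
    of the norm only the one without sign changes vanishes at the origin, and
    it is the square root series; the product of the others is a unit. *)
Lemma relpoly_unit j K : (j < K)%N -> exists q,
  ordge j.+1 (relpoly * q - sqrt_series d K (1 : F)).
Proof.
move=> jK.
pose tau (i : 'I_d) : {mpoly F[d]} := horner_alg ('X_i ^+ 2) (sqrt_poly F K).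
have tauE i : tau i = \sum_(k < K) sqrt_coef F k *: 'X_i ^+ (2 * k).
  rewrite /tau /sqrt_poly poly_def rmorph_sum /=; apply: eq_bigr => k _.
  by rewrite linearZ /= rmorphXn /= horner_algX mulr_algl exprM.
have tau2 i : ordge j.+1 (tau i ^+ 2 - ('X_i ^+ 2 + 4%:R)).
  have -> : tau i ^+ 2 - ('X_i ^+ 2 + 4%:R)
     = horner_alg ('X_i ^+ 2) (sqrt_poly F K * sqrt_poly F K - ('X + 4%:R%:P)).
    rewrite rmorphB rmorphM rmorphD /= horner_algX horner_algC expr2; congr (_ - (_ + _)).
    by rewrite scaler_nat.
  set r := _ - _; have r0 k : (k < K)%N -> r`_k = 0.
    by move=> kK; rewrite coefB sqrt_polyM // subrr.
  rewrite -[r]coefK poly_def rmorph_sum; apply: ordge_sum => k _ /=.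
  rewrite linearZ /= rmorphXn /= horner_algX mulr_algl -exprM.
  have [kK|Kk] := ltnP k K; first by rewrite r0 // scale0r; apply: ordge_zero.
  by apply: ordgeZ; apply: (ordgeW _ (@ordge_var _ _ i (2 * k))); lia.
pose ta := [tuple tau i | i < d].
have R1 : ordge j.+1 (relpoly - (normpoly \mPo ta)).
  rewrite -sq_halfE /relpoly; apply: ordge_comp => i.
  by rewrite !tnth_mktuple -opprB; apply/ordgeN/tau2.
pose rest := \prod_(sg | sg != [ffun=> false]) (lform sg \mPo ta).
have lformE sg : lform sg \mPo ta = \sum_i (-1) ^+ sg i *: tau i - (2 * d)%:R.
  rewrite /lform comp_mpolyB raddf_sum /= rmorph_nat; congr (_ - _).
  by apply: eq_bigr => i _; rewrite comp_mpolyZ comp_mpolyXU -tnth_nth tnth_mktuple.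
have N1 : normpoly \mPo ta = sqrt_series d K (1 : F) * rest.
  rewrite /normpoly rmorph_prod (bigD1 [ffun=> false]) //=; congr (_ * _).
  rewrite lformE; under eq_bigr do rewrite ffunE expr0 scale1r tauE.
  rewrite exchange_big /=.
  have -> : \sum_(k < K) \sum_(i < d) sqrt_coef F k *: 'X_i ^+ (2 * k)
       = \sum_(0 <= k < K) (sqrt_coef F k * 1 ^+ (2 * k)) *: psum F d k :> {mpoly F[d]}.
    by rewrite big_mkord; apply: eq_bigr => k _; rewrite expr1n mulr1 /psum scaler_sumr.
  rewrite big_ltn ?(leq_ltn_trans _ jK) // /sqrt_series addrAC -[RHS]add0r; congr (_ + _).
  rewrite expr1n mulr1 /psum muln0 (eq_bigr (fun=> 1)) => [|i _]; last by rewrite expr0.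
  by rewrite sumr_const card_ord scaler_nat -mulrnA mulnC subrr.
have tau0 i : (tau i)@_0%MM = 2.
  rewrite tauE raddf_sum; case: K jK {tau tauE tau2 ta R1 rest lformE N1} => // K _.
  rewrite big_ord_recl big1 /= => [|k _];
    first by rewrite mcoeffZ expr0 mcoeff1 eqxx mulr1 addr0.
  by rewrite mcoeffZ mpolyXn mcoeffX -mdeg_eq0 mdegMn mdeg1 mulr0.
have rest0 : rest@_0%MM != 0.
  rewrite /rest rmorph_prod /=; apply/prodf_neq0 => sg sgn.
  rewrite lformE mcoeffB raddf_sum /=.
  have -> : ((2 * d)%:R : {mpoly F[d]})@_0%MM = \sum_(i < d) 2.
    by rewrite sumr_const card_ord -mpolyC_nat mcoeffC eqxx mulr1 -mulrnA.
  have [i sgi] : exists i, sg i.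
    apply/existsP; apply: contraR sgn; rewrite negb_exists => /forallP h.
    by apply/eqP/ffunP => i; rewrite ffunE; apply/negbTE.
  rewrite -sumrB (eq_bigr (fun i => - (4 * (sg i)%:R))) => [|l _]; last first.
    by rewrite mcoeffZ tau0; case: (sg l) => /=; rewrite ?expr1 ?expr0; ring.
  rewrite sumrN oppr_eq0 -mulr_sumr mulf_neq0 ?pnatr_eq0 //.
  by rewrite -natr_sum pnatr_eq0 -lt0n (bigD1 i) //= sgi.
have [q hq] := ordge_inv j.+1 rest0.
exists q; have -> : relpoly * q - sqrt_series d K (1 : F)
   = (relpoly - (normpoly \mPo ta)) * q - sqrt_series d K (1 : F) * (1 - rest * q).
  by rewrite N1; ring.
by apply: ordgeB; [apply: ordgeMr|apply: ordgeMl].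
Qed.
End Norm.

(** * Codimension of the ideal of relations *)

Section Scaling.
Variables (F : numFieldType) (d j : nat).
Implicit Types (p q : {mpoly F[d]}) (v : tpoly F d j).

Definition dilate (a : F) v : tpoly F d j := [ffun m => a ^+ mdeg (bmnm m) * v m].

Lemma dilate_is_linear a : linear (dilate a).
Proof.
move=> c v w; apply/ffunP => m; rewrite !ffunE mulrDr; congr (_ + _).
by rewrite /GRing.scale /= mulrCA.
Qed.
HB.instance Definition _ a := GRing.isLinear.Build F (tpoly F d j) (tpoly F d j) _
  (dilate a) (dilate_is_linear a).

Definition dil_tuple (a : F) : d.-tuple {mpoly F[d]} := [tuple a *: 'X_i | i < d].

Lemma mcoeff_dil a p m : (p \mPo dil_tuple a)@_m = a ^+ mdeg m * p@_m.
Proof.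
have E m' : 'X_[m'] \mPo dil_tuple a = a ^+ mdeg m' *: 'X_[m'].
  rewrite comp_mpolyX [in RHS]mpolyXE_id mdegE -prodrXr -scaler_prod.
  by apply: eq_bigr => i _; rewrite tnth_mktuple exprZn.
rewrite comp_mpolyEX raddf_sum /= [in RHS](mpolyE p) raddf_sum /= mulr_sumr.
apply: eq_bigr => m' _; rewrite E !mcoeffZ mcoeffX /=.
by case: eqP => [->|]; rewrite ?mulr0 //; ring.
Qed.

Lemma tr_dil a p : tr j (p \mPo dil_tuple a) = dilate a (tr j p).
Proof. by apply/ffunP => m; rewrite !ffunE mcoeff_dil. Qed.

Lemma sqrt_series_dil K a b : sqrt_series d K b \mPo dil_tuple a = sqrt_series d K (a * b).
Proof.
rewrite /sqrt_series raddf_sum /=; apply: eq_bigr => k _.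
have psum_dil : psum F d k \mPo dil_tuple a = a ^+ (2 * k) *: psum F d k.
  rewrite /psum raddf_sum scaler_sumr; apply: eq_bigr => i _ /=.
  by rewrite rmorphXn /= comp_mpolyXU -tnth_nth tnth_mktuple exprZn.
by rewrite comp_mpolyZ psum_dil scalerA exprMn; congr (_ *: _); ring.
Qed.

Variable U : {vspace tpoly F d j}.
Hypothesis U_dil : forall a v, v \in U -> dilate a v \in U.

(** Dilations are automorphisms of the truncated ring, stabilise [U], and
    permute the dilates of the series. *)
Lemma codim_dil K a b : a != 0 ->
  (codim (U + limg (tmul j (sqrt_series d K (a * b)))) <=
    codim (U + limg (tmul j (sqrt_series d K b))))%N.
Proof.
move=> a0; pose D := linfun (dilate a : {linear _ -> _}).
have Dinj : lker D == 0%VS.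
  apply/lker0P => v w; rewrite !lfunE /= => /ffunP h; apply/ffunP => m.
  by have := h m; rewrite !ffunE => /(mulfI (expf_neq0 _ a0)).
have sub : (D @: (U + limg (tmul j (sqrt_series d K b))) <=
  U + limg (tmul j (sqrt_series d K (a * b))))%VS.
  rewrite limgD; apply: addvS; apply/subvP => _ /memv_imgP[v vU ->]; rewrite lfunE /=.
    exact: U_dil.
  have /mem_limg_tmul[p ->] := vU; apply/mem_limg_tmul; exists (p \mPo dil_tuple a).
  by rewrite -tr_dil rmorphM /= sqrt_series_dil.
have := dimvS sub; rewrite limg_dim_eq; last by rewrite (eqP Dinj) capv0.
by move=> h; rewrite leq_sub2l.
Qed.

Lemma codim_dilE K a : a != 0 ->
  codim (U + limg (tmul j (sqrt_series d K a))) =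
    codim (U + limg (tmul j (sqrt_series d K 1))).
Proof.
move=> a0; apply/eqP; rewrite eqn_leq; apply/andP; split.
  by have := codim_dil K 1 a0; rewrite mulr1.
by have := codim_dil K a (a := a^-1); rewrite mulVf //; apply; rewrite invr_neq0.
Qed.

Hypothesis U_ideal : forall f, (tmul j f @: U <= U)%VS.
Hypothesis U_proper : tr j 1 \notin U.

(** Interpolation between [codim U] and the bounded codimension reached with
    [d] dilates. The codimension for one generic dilate is that for the
    undilated series, because all single dilates behave alike by [codim_dilE]. *)
Theorem codim_relpoly : (0 < d)%N ->
  (codim (U + limg (tmul j (relpoly F d))) ^ d
     <= 2 ^ 'C(d, 2) * codim U ^ d.-1 * (2 * d) ^ d)%N.
Proof.
move=> d0; pose K := (j + d).+1; pose f t := tmul j (sqrt_series d K (t.+1%:R : F)).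
have s1 : (codim (U + limg (tmul j (relpoly F d))) <=
  codim (U + limg (tmul j (sqrt_series d K 1))))%N.
  apply: codimS; apply: addvS => //; apply/subvP => v /mem_limg_tmul[p ->].
  have [|q hq] := @relpoly_unit F d j K; first by rewrite ltnS leq_addr.
  apply/mem_limg_tmul; exists (q * p); apply: tr_eq.
  by rewrite mulrA -mulrBl -opprB mulNr; apply/ordgeN/ordgeMr.
apply: leq_trans (_ : codim (U + limg (tmul j (sqrt_series d K 1))) ^ d <= _)%N.
  by rewrite leq_exp2r.
have low v : v \in U -> (emb v)@_0%MM = 0.
  move=> vU; apply/eqP; apply: contraNT U_proper => /(ordge_inv j.+1)[q hq].
  have -> : tr j 1 = tmul j q (tr j (emb v)) by rewrite tmul_tr mulrC; apply: tr_eq.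
  by rewrite trK; apply: (subvP (U_ideal q)); apply: memv_img.
have comm : forall s t, (f s \o f t = f t \o f s)%VF by move=> s t; apply: tmul_comm.
apply: (@codim_generic _ _ U f comm (fun t => U_ideal _) d _ ((2 * d) ^ d)%N d0).
- move=> I; rewrite lt0n; apply: contraNN U_proper => /eqP cI.
  suff h v : v \in fspan U f I -> (emb v)@_0%MM = 0.
    have /h : tr j 1 \in fspan U f I.
      suff -> : fspan U f I = fullv by rewrite memvf.
      by apply/eqP; rewrite eqEdim subvf /=; rewrite -(codimK (fspan U f I)) cI.
    move=> h0; exfalso; have := @emb_tr F d j 1 0%MM; rewrite mdeg0 => /(_ isT)/eqP.
    by rewrite mcoeffB h0 subr0 mcoeff1 eqxx oner_eq0.
  have emb0 t (w : tpoly F d j) : w \in limg (f t) -> (emb w)@_0%MM = 0.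
    move/mem_limg_tmul => [p ->].
    have := @emb_tr F d j (sqrt_series d K t.+1%:R * p) 0%MM; rewrite mdeg0 => /(_ isT)/eqP.
    rewrite mcoeffB subr_eq0 => /eqP <-.
    apply: (@ordgeMr _ _ 1) => //; last by rewrite mdeg0.
    rewrite /sqrt_series big_nat; apply: ordge_sum => k /andP[k1 _];
      apply/ordgeZ/ordge_sum => i _.
    by apply: (ordgeW _ (@ordge_var _ _ i (2 * k))); lia.
  elim/last_ind: I v {cI} => [|I t IH] v.
    by rewrite /fspan big_nil addv0; apply: low.
  rewrite fspan_rcons => /memv_addP[x /IH x0 [y /emb0 y0 ->]].
  by rewrite linearD mcoeffD x0 y0 addr0.
- by move=> t; rewrite codim_dilE // pnatr_eq0.
- move=> I uI sI.
  pose s (l : 'I_d) : F := (nth 0%N I l).+1%:R.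
  apply: (@codim_sqrt_series F d j K _ _ _ s).
  + move=> g; have cg t : (tmul j g \o f t = f t \o tmul j g)%VF by apply: tmul_comm.
    elim/last_ind: I {uI sI s} => [|I t IH]; first by rewrite /fspan big_nil addv0.
    by rewrite fspan_rcons limgD addvS // -limg_comp cg limg_comp limgS // subvf.
  + by rewrite ltnS.
  + by move=> l; rewrite pnatr_eq0.
  + move=> l l' /eqP; rewrite eqrXn2 ?ler0n // eqr_nat eqSS nth_uniq ?sI //.
    by move=> /eqP/val_inj.
  + move=> l; apply: (subvP (addvSr _ _)).
    have lI : nth 0%N I l \in I by rewrite mem_nth // sI.
    rewrite (big_rem _ lI) /=; apply: (subvP (addvSl _ _)).
    by apply/mem_limg_tmul; exists 1; rewrite mulr1.
Qed.
End Scaling.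

(** * Polynomials in commuting operators *)

Section Action.
Variables (F : fieldType) (M : lmodType F) (d : nat).
Variable (th : 'I_d -> {linear M -> M}).
Hypothesis thC : forall i k v, th i (th k v) = th k (th i v).
Implicit Types (p q : {mpoly F[d]}) (v : M).

Definition word (m : 'X_{1..d}) : seq 'I_d := flatten [seq nseq (m i) i | i <- enum 'I_d].

Definition run (s : seq 'I_d) v := foldr (fun i => th i) v s.

(** The polynomial [p] evaluated at the commuting operators [th i]. *)
Definition act p v : M := \sum_(m <- msupp p) p@_m *: run (word m) v.

Lemma count_word m i : count_mem i (word m) = m i.
Proof.
rewrite count_flatten -map_comp sumnE big_map big_enum /=.
rewrite (bigD1 i) //= big1 => [|k ki]; first by rewrite count_nseq /= eqxx mul1n addn0.
by rewrite count_nseq /= (negbTE ki).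
Qed.

Lemma size_word m : size (word m) = mdeg m.
Proof.
rewrite size_flatten /shape -map_comp sumnE big_map big_enum mdegE /=.
by apply: eq_bigr => i _; rewrite size_nseq.
Qed.

Lemma run_cat s t v : run (s ++ t) v = run s (run t v).
Proof. by rewrite /run foldr_cat. Qed.

Lemma run_comm s i v : run s (th i v) = th i (run s v).
Proof. by elim: s => //= k s ->; rewrite thC. Qed.

Lemma run_perm s t v : perm_eq s t -> run s v = run t v.
Proof.
elim: s t => [|i s IH] t; first by rewrite perm_sym => /perm_nilP ->.
move=> st; have it : i \in t by rewrite -(perm_mem st) mem_head.
case/splitPr: it st => t1 t2 st.
rewrite run_cat /= run_comm -run_cat (IH (t1 ++ t2)) //.
by move: st; rewrite perm_sym perm_catC /= perm_cons perm_catC perm_sym.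
Qed.

Lemma run_is_linear s : linear (run s).
Proof. by move=> a v w; elim: s => //= i s ->; rewrite linearP. Qed.
HB.instance Definition _ s := GRing.isLinear.Build F M M _ (run s) (run_is_linear s).

Lemma runD m m' v : run (word (m + m')%MM) v = run (word m) (run (word m') v).
Proof.
rewrite -run_cat; apply: run_perm; apply/allP => i _ /=.
by rewrite count_cat !count_word mnmDE.
Qed.

Lemma actwE k p v : (msize p <= k)%N ->
  act p v = \sum_(m : 'X_{1..d < k}) p@_m *: run (word m) v.
Proof.
move=> le_pk; set I : subFinType _ := 'X_{1..d < k}.
rewrite /act (big_mksub I) ?msupp_uniq //=; first last.
  by move=> x /msize_mdeg_lt /leq_trans; apply.
rewrite big_rmcond //= => m /memN_msupp_eq0 ->.
by rewrite scale0r.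
Qed.

Lemma act_linl a p q v : act (a *: p + q) v = a *: act p v + act q v.
Proof.
pose k := maxn (msize (a *: p + q)) (maxn (msize p) (msize q)).
rewrite !(@actwE k) ?leq_max ?leqnn ?orbT // scaler_sumr -big_split /=.
by apply: eq_bigr => m _; rewrite mcoeffD mcoeffZ scalerDl scalerA.
Qed.

Lemma act0l v : act 0 v = 0. Proof. by rewrite /act msupp0 big_nil. Qed.
Lemma actDl p q v : act (p + q) v = act p v + act q v.
Proof. by rewrite -[p]scale1r act_linl !scale1r. Qed.
Lemma actZl a p v : act (a *: p) v = a *: act p v.
Proof. by rewrite -[a *: p]addr0 act_linl act0l addr0. Qed.
Lemma actNl p v : act (- p) v = - act p v.
Proof. by rewrite -[- p]scaleN1r actZl scaleN1r. Qed.
Lemma act_suml (I : Type) (r : seq I) (P : pred I) (f : I -> {mpoly F[d]}) v :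
  act (\sum_(i <- r | P i) f i) v = \sum_(i <- r | P i) act (f i) v.
Proof. exact: (big_morph (act^~ v) (fun p q => actDl p q v) (act0l v)). Qed.

Lemma actX m v : act 'X_[m] v = run (word m) v.
Proof. by rewrite /act msuppX big_seq1 mcoeffX eqxx scale1r. Qed.

Lemma act_var i v : act 'X_i v = th i v.
Proof.
rewrite actX (@run_perm _ [:: i]) //; apply/allP => k _ /=.
by rewrite count_word mnm1E addn0 eq_sym.
Qed.

Lemma act1 v : act 1 v = v.
Proof.
rewrite -mpolyX0 actX (@run_perm _ [::]) //; apply/allP => k _ /=.
by rewrite count_word mnm0E.
Qed.

Lemma act_nat k v : act k%:R v = k%:R *: v.
Proof. by rewrite -scaler_nat actZl act1. Qed.

Lemma act_is_linear p : linear (act p).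
Proof.
move=> a v w; rewrite /act scaler_sumr -big_split /=; apply: eq_bigr => m _.
by rewrite linearP scalerDr !scalerA mulrC.
Qed.
HB.instance Definition _ p := GRing.isLinear.Build F M M _ (act p) (act_is_linear p).

Lemma actM p q v : act (p * q) v = act p (act q v).
Proof.
rewrite [in LHS](mpolyE p) mulr_suml act_suml [RHS]/act; apply: eq_bigr => m _.
rewrite -scalerAl actZl; congr (_ *: _).
rewrite [in LHS](mpolyE q) mulr_sumr act_suml [in RHS]/act linear_sum /=;
  apply: eq_bigr => m' _.
by rewrite -scalerAr actZl -mpolyXD actX runD linearZ.
Qed.

Lemma actXn p n v : act (p ^+ n) v = iter n (act p) v.
Proof. by elim: n => [|n IH]; [rewrite act1|rewrite exprS actM IH]. Qed.

End Action.

Section ActionComp.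
Variables (F : fieldType) (M : lmodType F) (d e : nat).
Variable (th : 'I_d -> {linear M -> M}).
Hypothesis thC : forall i k v, th i (th k v) = th k (th i v).

Lemma act_comp (a : e.-tuple {mpoly F[d]}) (p : {mpoly F[e]}) v :
  act th (p \mPo a) v = act (fun i => act th (tnth a i) : {linear M -> M}) p v.
Proof.
rewrite comp_mpolyEX act_suml [RHS]/act; apply: eq_bigr => m _.
rewrite actZl; congr (_ *: _); rewrite comp_mpolyX.
rewrite /word /run; have -> : \prod_(i < e) tnth a i ^+ m i =
  \prod_(i <- enum 'I_e) tnth a i ^+ m i.
  by rewrite big_enum.
elim: (enum _) => [|i s IH]; first by rewrite big_nil act1.
rewrite big_cons actM // IH /= foldr_cat; elim: (m i) => [|k IHk]; first by rewrite act1.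
by rewrite exprS actM // IHk.
Qed.
End ActionComp.

Lemma act_ext (F : fieldType) (M : lmodType F) (d : nat) (th th' : 'I_d -> {linear M -> M})
  (p : {mpoly F[d]}) v : (forall i v, th i v = th' i v) -> act th p v = act th' p v.
Proof.
move=> h; rewrite /act; apply: eq_bigr => m _; congr (_ *: _).
by rewrite /run; elim: (word m) => //= i s ->.
Qed.

(** * Polynomials acting on harmonic functions *)

Section LatticeAction.
Variables (F : numFieldType) (d : nat).
Notation Z := 'rV[int]_d.
Notation fn := (fn F d).
Implicit Types (u v : fn).
Notation lap := (@lap F d).
Let wdC := @wdC F d.
Let wsC := @wsC F d.
Notation actw := (act (fun i => wd i : {linear fn -> fn})).
Notation actt := (act (fun i => ws i : {linear fn -> fn})).

(** The norm, evaluated at the operators [ws i], has the Laplacian as a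
    factor. *)
Lemma relpoly_kill u : lap u = 0 -> actw (relpoly F d) u = 0.
Proof.
move=> lu; have [q hq] := sq_half_sq F d.
transitivity (actt (sq_half F d \mPo [tuple 'X_i ^+ 2 | i < d]) u); last first.
  rewrite hq (actM wsC) [X in act _ q X](_ : _ = 0) ?linear0 // -[RHS]lu /lap.
  rewrite actDl actNl act_suml; congr (_ - _).
    by apply: eq_bigr => i _; rewrite (act_var wsC).
  by rewrite (act_nat wsC).
rewrite /relpoly (act_comp wdC) (act_comp wsC); apply: act_ext => i v /=.
rewrite !tnth_mktuple actDl !(actXn wdC, actXn wsC) /= !(act_var wdC, act_var wsC).
by rewrite (act_nat wdC); apply/esym/ws_sq.
Qed.

Definition xm i v : fn := fun x => (x 0 i)%:~R * v x.

(** The commutator of the Laplacian and a coordinate is a difference operator. *)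
Lemma lap_xm i v : lap (xm i v) = xm i (lap v) + wd i v.
Proof.
apply/funext => x; rewrite !(fnE, lapE, wdE) /xm lapE mulrBr mulr_sumr addrAC.
rewrite [_ * (_%:R * _)]mulrCA; congr (_ - _).
rewrite (bigD1 i) //= [in RHS](bigD1 i) //= addrAC; congr (_ + _).
  rewrite !mxE /= !eqxx /= intrD intrB.
  move: (v _ : F) (v _ : F) => a b. have -> : 1%:~R = 1 :> F by []. ring.
by apply: eq_bigr => k ki; rewrite !mxE /= [i == k]eq_sym (negbTE ki) ?addr0 ?subr0; ring.
Qed.

Lemma iter_lap0 k : iter k lap 0 = 0.
Proof. by elim: k => //= k ->; rewrite linear0. Qed.

Lemma iter_lap_xm k i v :
  iter k lap (xm i v) = xm i (iter k lap v) + k%:R *: wd i (iter k.-1 lap v).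
Proof.
elim: k => [|k IH]; first by rewrite scale0r addr0.
rewrite iterS IH linearD linearZ /= lap_xm lap_wd -addrA; congr (_ + _).
case: k {IH} => [|k] /=; first by rewrite scale0r addr0 scale1r.
by rewrite -[k.+2%:R]natr1 scalerDl scale1r addrC.
Qed.

Definition xrun (s : seq 'I_d) v := foldr xm v s.
Notation wrun := (run (fun i => wd i : {linear fn -> fn})).

(** By [lap_xm] each Laplacian removes one coordinate and puts a difference
    operator in its place; the factorial counts the orders in which this can
    happen. *)
Lemma iter_lap_xrun u s : lap u = 0 ->
  iter (size s) lap (xrun s u) = (size s)`!%:R *: wrun s u
  /\ forall k, (size s < k)%N -> iter k lap (xrun s u) = 0.
Proof.
move=> lu; elim: s => [|i s [IH1 IH2]] /=.
  split; first by rewrite scale1r.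
  by case=> // k _; rewrite iterSr lu iter_lap0.
split.
  rewrite -[lap _]/(iter (size s).+1 lap (xm i (xrun s u))) iter_lap_xm IH2 //= IH1.
  have -> : xm i 0 = 0 by apply/funext => x; rewrite /xm fnE mulr0.
  by rewrite add0r linearZ /= scalerA -natrM -factS.
move=> k sk; rewrite iter_lap_xm !IH2 //; try lia.
rewrite linear0 scaler0 addr0.
by apply/funext => x; rewrite /xm fnE mulr0.
Qed.
End LatticeAction.

(** * Coordinate multiples of a harmonic function *)

Section Homog.
Variables (F : fieldType) (d : nat).
Implicit Types p : {mpoly F[d]}.

Lemma pihomog_varM k i p :
  pihomog mdeg k.+1 ('X_i * p) = 'X_i * pihomog mdeg k p.
Proof.
rewrite [p]mpolyE mulr_sumr !linear_sum mulr_sumr; apply: eq_bigr => m _ /=.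
rewrite -scalerAr !linearZ /= -scalerAr; congr (_ *: _).
rewrite -mpolyXD !pihomogX /= mdegD mdeg1 add1n eqSS.
by case: eqP => _; rewrite ?mulr0 // mpolyXD.
Qed.

Lemma pihomog0_varM i p : pihomog mdeg 0 ('X_i * p) = 0.
Proof.
rewrite [p]mpolyE mulr_sumr linear_sum big1 // => m _ /=.
by rewrite -scalerAr !linearZ /= -mpolyXD pihomogX /= mdegD mdeg1 scaler0.
Qed.

Lemma pihomog_ordge k e p : (k < e)%N -> ordge e p -> pihomog mdeg k p = 0.
Proof.
move=> ke h; rewrite pihomogE big1 // => m /eqP mk.
by rewrite h ?scale0r ?mk.
Qed.

Lemma mcoeff_pihomog k p m : (pihomog mdeg k p)@_m = (mdeg m == k)%:R * p@_m.
Proof.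
rewrite [p]mpolyE (linear_sum (pihomog mdeg k)) !(raddf_sum (mcoeff m)) mulr_sumr;
  apply: eq_bigr => m' _ /=.
rewrite linearZ /= !mcoeffZ pihomogX mcoeffX.
case: eqP => [<-|mk]; rewrite ?mcoeffX ?mcoeff0.
  by case: (m' =P m) => [->|]; rewrite ?eqxx ?mulr0 ?mul1r.
by case: (m' =P m) => [<-|]; rewrite ?mulr0 // (introF eqP mk) mul0r.
Qed.
End Homog.

Section Counting.
Variables (F : numFieldType) (d n : nat) (u : fn F d).
Hypothesis lap_u : lap u = 0.
Notation box := (box d n).
Notation bfun := (bfun F d n).
Notation wdl := (fun i => wd i : {linear fn F d -> fn F d}).
Notation actw := (act wdl).
Let wdC := @wdC F d.

Definition xmon m : fn F d := xrun (word m) u.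
Definition wmon m : fn F d := run wdl (word m) u.

Lemma xrun_supp s (v : fn F d) x : v x = 0 -> xrun s v x = 0.
Proof. by move=> vx; elim: s => //= i s IH; rewrite /xm IH mulr0. Qed.

Definition polyspan k : {vspace bfun} :=
  <<[seq restr n n (xmon (bmnm m)) | m <- enum [set: 'X_{1..d < k}]]>>%VS.
(** The box of radius [n - k] is what is left of the box of radius [n] after
    [k] applications of the Laplacian. *)
Definition wspan k : {vspace bfun} :=
  <<[seq restr n (n - k) (wmon (bmnm m)) | m <- enum [set m : 'X_{1..d < k.+1} | mdeg m
    == k]]>>%VS.
Definition gdim k := \dim (wspan k).

Lemma mem_wspan k m : mdeg m = k -> restr n (n - k) (wmon m) \in wspan k.
Proof.
move=> mk; have h : (mdeg m < k.+1)%N by rewrite mk.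
apply: memv_span; apply/mapP; exists (BMultinom h) => //.
by rewrite mem_enum inE /= mk.
Qed.

Lemma mem_polyspan k m : (mdeg m < k)%N -> restr n n (xmon m) \in polyspan k.
Proof.
by move=> h; apply: memv_span; apply/mapP; exists (BMultinom h); rewrite ?mem_enum ?inE.
Qed.

(** A coordinate multiple of [u] vanishes wherever [u] does. *)
Lemma dim_polyspan k : (\dim (polyspan k) <= #|supp_box n u|)%N.
Proof.
apply: dim_supp => phi; set s := in_tuple [seq restr n n (xmon (bmnm m)) | m <- enum
  [set: 'X_{1..d < k}]].
move/(@coord_span _ _ _ s) => -> b.
rewrite inE negbK => /eqP ub; rewrite sum_ffunE big1 // => i _; rewrite ffunE.
have : s`_i \in s by rewrite mem_nth ?size_tuple.
case/mapP => m _ ->; rewrite ffunE inQ_pt /xmon xrun_supp //.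
by rewrite [_ *: _]mulr0.
Qed.

Definition lapk k : fn F d -> fn F d := iter k (@lap F d).
Lemma lapk_is_linear k : linear (lapk k).
Proof. by move=> a v w; rewrite /lapk; elim: k => //= k ->; rewrite linearP. Qed.
HB.instance Definition _ k := GRing.isLinear.Build F (fn F d) (fn F d) _ (lapk k)
  (lapk_is_linear k).

(** The [k]-th power of the Laplacian maps [polyspan k.+1] onto a space
    containing [wspan k], and its kernel contains [polyspan k]. *)
Lemma gdim_step k : (k <= n)%N -> (gdim k + \dim (polyspan k) <= \dim (polyspan k.+1))%N.
Proof.
move=> kn; pose Th := linfun (restr n (n - k) \o (lapk k \o @ext F d n)).
have ThE m : Th (restr n n (xmon m)) = restr n (n - k) (lapk k (xmon m)).
  rewrite lfunE /=; apply: restr_local => //; first exact: leq_subr.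
  by move=> w wn; apply: van_iter_lap; rewrite subnK.
have s1 : (wspan k <= Th @: polyspan k.+1)%VS.
  apply/span_subvP => x /mapP[m]; rewrite mem_enum inE => /eqP mk ->{x}.
  have [h _] := iter_lap_xrun (word (bmnm m)) lap_u; rewrite size_word mk in h.
  have -> : wmon (bmnm m) = (k`!%:R)^-1 *: lapk k (xmon (bmnm m)).
    by rewrite /lapk h scalerA mulVf ?scale1r // pnatr_eq0 -lt0n fact_gt0.
  rewrite linearZ /= -ThE; apply/rpredZ/memv_img/mem_polyspan.
  by rewrite ltnS mk.
have s2 : (polyspan k <= polyspan k.+1 :&: lker Th)%VS.
  apply/span_subvP => x /mapP[m _ ->{x}]; rewrite memv_cap memv_ker ThE.
  rewrite mem_polyspan ?(leq_trans (bmdeg m)) //=.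
  have [_ h] := iter_lap_xrun (word (bmnm m)) lap_u.
  by rewrite /lapk h ?linear0 // size_word bmdeg.
rewrite -(limg_ker_dim Th (polyspan k.+1)) addnC; apply: leq_add; exact: dimvS.
Qed.

Lemma sum_gdim k : (k <= n.+1)%N -> (\sum_(i < k) gdim i <= #|supp_box n u|)%N.
Proof.
move=> kn; apply: leq_trans (dim_polyspan k).
elim: k kn => [|k IH] kn; first by rewrite big_ord0.
rewrite big_ord_recr /= addnC; apply: leq_trans (gdim_step _) => //.
by rewrite leq_add2l IH // ltnW.
Qed.

Lemma act_pihomog_wspan k p : restr n (n - k) (actw (pihomog mdeg k p) u) \in wspan k.
Proof.
rewrite pihomogE act_suml linear_sum; apply: rpred_sum => m /eqP mk /=.
by rewrite actZl actX linearZ /=; apply/rpredZ/mem_wspan.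
Qed.

Variable j : nat.
Hypothesis jn : (j <= n)%N.

Definition hom_values (v : tpoly F d j) : {ffun 'I_j.+1 -> bfun} :=
  [ffun k : 'I_j.+1 => restr n (n - k) (actw (pihomog mdeg k (emb v)) u)].
Lemma hom_values_is_linear : linear hom_values.
Proof.
move=> a v w; apply/ffunP => k; rewrite !ffunE !linearP /=.
by rewrite actDl actZl linearP.
Qed.
HB.instance Definition _ := GRing.isLinear.Build F (tpoly F d j) {ffun 'I_j.+1 ->
  bfun} _ hom_values hom_values_is_linear.

(** The truncated polynomials each of whose homogeneous parts, applied to [u],
    vanishes on the box belonging to its degree. Separating the degrees makes
    the space stable under dilations. *)
Definition relspace : {vspace tpoly F d j} := lker (linfun hom_values).

Lemma mem_relspace p : tr j p \in relspace <->
  forall k, (k <= j)%N -> van (n - k) (actw (pihomog mdeg k p) u).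
Proof.
have E k : (k <= j)%N -> pihomog mdeg k (emb (tr j p)) = pihomog mdeg k p.
  move=> kj; apply/eqP; rewrite eq_sym -subr_eq0 -linearB /= (@pihomog_ordge _ _ _ j.+1) //.
  exact: emb_tr.
rewrite memv_ker lfunE /=; split=> [/eqP/ffunP h k kj|h].
  have := h (Ordinal (kj : (k < j.+1)%N)); rewrite !ffunE /= E //.
  by move/restr_eq0; apply; exact: leq_subr.
apply/eqP/ffunP => k; rewrite !ffunE E -1?ltnS //; apply/restr_eq0; first exact: leq_subr.
by apply: h; rewrite -ltnS.
Qed.

Lemma relspace_var i p : tr j p \in relspace -> tr j ('X_i * p) \in relspace.
Proof.
move=> /mem_relspace h; apply/mem_relspace => -[|k] kj.
  by rewrite pihomog0_varM act0l; apply: van0.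
rewrite pihomog_varM (actM wdC) (act_var wdC); apply: van_wd.
by rewrite subnSK ?(leq_trans kj) //; apply: h; apply: ltnW.
Qed.

Lemma relspace_ideal f : (tmul j f @: relspace <= relspace)%VS.
Proof.
apply/subvP => _ /memv_imgP[v vU ->]; rewrite -[v]trK in vU *.
rewrite tmul_tr [f]mpolyE mulr_suml linear_sum; apply: rpred_sum => m _ /=.
rewrite -scalerAl linearZ /=; apply: rpredZ; rewrite mpolyXE_id.
move: vU; elim/big_rec: _ => [|i q _ IH]; first by rewrite mul1r.
elim: (m i) => [|k IHk] vU; first by rewrite mul1r; apply: IH.
by rewrite exprS -!mulrA; apply: relspace_var; rewrite mulrA; apply: IHk.
Qed.

Lemma relspace_dil a v : v \in relspace -> dilate a v \in relspace.
Proof.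
move=> vU; rewrite -[v]trK -tr_dil; move: vU; rewrite -{1}[v]trK => /mem_relspace h.
apply/mem_relspace => k kj.
have -> : pihomog mdeg k (emb v \mPo dil_tuple d a) = a ^+ k *: pihomog mdeg k (emb v).
  apply/mpolyP => m; rewrite mcoeffZ !mcoeff_pihomog mcoeff_dil.
  by case: eqP => [->|]; rewrite ?mul1r // !mul0r mulr0.
by rewrite actZl -[_ *: _]addr0; apply: van_lin => //; apply: h.
Qed.

Lemma relspace_proper : u 0 != 0 -> tr j 1 \notin relspace.
Proof.
move=> u0; apply: contraNN u0 => /mem_relspace /(_ 0%N isT).
rewrite -mpolyX0 pihomogX /= mdeg0 eqxx mpolyX0 (act1 wdC) subn0 => /(_ 0).
by move=> ->//; apply: inQ0.
Qed.

Definition single (k : 'I_j.+1) (phi : bfun) : {ffun 'I_j.+1 -> bfun} :=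
  [ffun l => if l == k then phi else 0].
Lemma single_is_linear k : linear (single k).
Proof.
by move=> a v w; apply/ffunP => l; rewrite !ffunE; case: eqP => // _; rewrite scaler0 addr0.
Qed.
HB.instance Definition _ k := GRing.isLinear.Build F bfun {ffun 'I_j.+1 -> bfun} _
  (single k) (single_is_linear k).

(** The quotient by [relspace] embeds into the direct sum of the spaces [wspan
    k]. *)
Lemma codim_relspace : (codim relspace <= \sum_(k < j.+1) gdim k)%N.
Proof.
rewrite /codim -[X in (X - _)%N](limg_ker_dim (linfun hom_values)) capfv addKn.
pose singleL k := linfun (single k).
have s1 : (limg (linfun hom_values) <= \sum_k singleL k @: wspan k)%VS.
  apply/subvP => _ /memv_imgP[v _ ->]; rewrite lfunE /=.
  have -> : hom_values v = \sum_k singleL k (hom_values v k).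
    apply/ffunP => l; rewrite sum_ffunE (bigD1 l) //= big1 => [|k kl].
      by rewrite addr0 lfunE /= !ffunE eqxx.
    by rewrite lfunE /= ffunE eq_sym (negbTE kl).
  apply: rpred_sum => k _; apply: (subvP (sumv_sup k _ (subvv _))) => //.
  by apply: memv_img; rewrite ffunE act_pihomog_wspan.
apply: leq_trans (dimvS s1) _; apply: leq_trans (dimv_leq_sum _ _ _) _.
apply: leq_sum => k _; rewrite /gdim -(limg_ker_dim (singleL k) (wspan k)).
exact: leq_addl.
Qed.
End Counting.

(** * The span of the low degree values *)

Lemma msize_leP (F : fieldType) d k (p : {mpoly F[d]}) :
  (forall m, (k <= mdeg m)%N -> p@_m = 0) -> (msize p <= k)%N.
Proof.
move=> h; rewrite msizeE; apply/bigmax_leqP_seq => m mp _; rewrite ltnNge.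
by apply/negP => /h; apply/eqP; rewrite -mcoeff_msupp.
Qed.

Lemma msize_emb (F : fieldType) d j (v : tpoly F d j) : (msize (emb v) <= j.+1)%N.
Proof. by apply: msize_leP => m jm; apply: mcoeff_emb_high. Qed.

Section Window.
Variables (F : numFieldType) (d n : nat) (u : fn F d).
Hypothesis lap_u : lap u = 0.
Notation box := (box d n).
Notation bfun := (bfun F d n).
Notation wdl := (fun i => wd i : {linear fn F d -> fn F d}).
Notation actw := (act wdl).
Let wdC := @wdC F d.
Notation wspan := (wspan n u).
Notation gdim := (gdim n u).
Notation relspace := (relspace n u).

Variables (j r : nat).
Let c := msize (relpoly F d).
Hypothesis jcr : (j + c + r <= n)%N.

Definition observe (v : tpoly F d j) : bfun := restr n r (actw (emb v) u).
Lemma observe_is_linear : linear observe.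
Proof. by move=> a v w; rewrite /observe !linearP /= actDl actZl linearP. Qed.
HB.instance Definition _ := GRing.isLinear.Build F (tpoly F d j) bfun _ observe
  observe_is_linear.

Definition cutspan k : {vspace bfun} := (linfun (restr n r \o @ext F d n) @: wspan k)%VS.

Lemma dim_cutspan k : (\dim (cutspan k) <= gdim k)%N.
Proof. by rewrite /gdim -(limg_ker_dim (linfun (restr n r \o @ext F d n)) (wspan k))
  leq_addl. Qed.

Lemma act_cutspan k p : (k + r <= n)%N ->
  restr n r (actw (pihomog mdeg k p) u) \in cutspan k.
Proof.
move=> kr; have rn : (r <= n)%N by lia.
set v := actw _ u.
suff -> : restr n r v = linfun (restr n r \o @ext F d n) (restr n (n - k) v).
  exact/memv_img/act_pihomog_wspan.
rewrite lfunE /=; apply/eqP; rewrite eq_sym -subr_eq0 -linearB /=; apply/eqP.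
apply: (proj2 (restr_eq0 _ rn)).
by apply: (@vanW _ _ (n - k)); [lia|apply: ext_restr; exact: leq_subr].
Qed.

(** The degrees just above [j] in which truncation at degree [j] of a multiple
    of [relpoly] leaves an error. *)
Definition winspan : {vspace bfun} := (\sum_(k < c) cutspan (j.+1 + k))%VS.

Lemma act_winspan q : ordge j.+1 q -> (msize q <= j + c)%N ->
  restr n r (actw q u) \in winspan.
Proof.
move=> qj qc; rewrite (@pihomog_partitionE _ _ mdeg (j.+1 + c) q); last first.
  apply: leq_trans qc _; lia.
rewrite act_suml linear_sum; apply: rpred_sum => k _ /=.
have [kj|kj] := ltnP k j.+1; first by rewrite (pihomog_ordge kj qj) act0l linear0 rpred0.
have kc : (k - j.+1 < c)%N by have := ltn_ord k; lia.
apply: (subvP (sumv_sup (Ordinal kc) _ (subvv _))) => //=.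
rewrite subnKC //; apply: act_cutspan; have := ltn_ord k; lia.
Qed.

Lemma observe_relspace v : v \in relspace j -> observe v = 0.
Proof.
rewrite -[v]trK => /mem_relspace h; rewrite /observe trK.
have rn : (r <= n)%N by lia.
apply: (proj2 (restr_eq0 _ rn)).
rewrite (@pihomog_partitionE _ _ mdeg j.+1 (emb v)); last first.
  by apply/msize_emb.
rewrite act_suml; apply: van_sum => k _.
apply: (@vanW _ _ (n - k)); first by have := ltn_ord k; lia.
by apply: h; rewrite -ltnS.
Qed.

(** The multiple itself kills [u]; only the terms cut off by the truncation
    contribute. *)
Lemma observe_multiple v : v \in limg (tmul j (relpoly F d)) -> observe v \in winspan.
Proof.
move=> /mem_limg_tmul[p ->]; rewrite -tmul_tr -[tr j p]trK tmul_tr.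
set e := emb (tr j p); pose q := emb (tr j (relpoly F d * e)) - relpoly F d * e.
have -> : observe (tr j (relpoly F d * e)) = restr n r (actw q u).
  rewrite /observe /q actDl actNl mulrC (actM wdC) relpoly_kill // linear0 oppr0 addr0.
  by rewrite mulrC.
apply: act_winspan; first by rewrite /q -opprB; apply/ordgeN/emb_tr.
have [R0|R0] := eqVneq (relpoly F d) 0.
  by rewrite /q R0 mul0r linear0 linear0 subr0 mmeasure0.
have c0 : (0 < c)%N by rewrite /c lt0n mmeasure_poly_eq0.
apply: leq_trans (mmeasureD_le _ _ _) _; rewrite geq_max; apply/andP; split.
  by apply: leq_trans (msize_emb _) _; lia.
rewrite mmeasureN; have [e0|e0] := eqVneq e 0; first by rewrite e0 mulr0 mmeasure0.
rewrite msizeM // -/c; have := msize_emb (tr j p); rewrite -/e; move: c0; clear;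
  move: c (msize e) => a b.
lia.
Qed.

(** A complement of the ideal [relspace j + limg (tmul j (relpoly F d))] is
    mapped onto the range modulo [winspan]. *)
Lemma dim_observe :
  (\dim (limg (linfun observe))
     <= codim (relspace j + limg (tmul j (relpoly F d))) + \sum_(k < c) gdim (j.+1 + k))%N.
Proof.
set U := (_ + _)%VS; pose f := linfun observe.
have sf : (limg f <= f @: U^C + winspan)%VS.
  rewrite -(addv_complf U) addvC limgD addvS //; apply/subvP => _ /memv_imgP[v vU ->].
  have /memv_addP[x xU [y yU ->]] := vU; rewrite linearD /= !lfunE /=.
  by rewrite observe_relspace // add0r observe_multiple.
apply: leq_trans (dimvS sf) _; apply: leq_trans (dimv_add_leqif _ _).1 _.
apply: leq_add.
  by rewrite /codim -dimv_compl -(limg_ker_dim f (U^C)%VS) leq_addl.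
apply: leq_trans (dimv_leq_sum _ _ _) _; apply: leq_sum => k _; exact: dim_cutspan.
Qed.
End Window.

(** * Translates and the uncertainty principle *)

Section Translates.
Variables (F : numFieldType) (d n : nat) (u : fn F d).
Notation wdl := (fun i => wd i : {linear fn F d -> fn F d}).
Notation actw := (act wdl).
Let wdC := @wdC F d.
Notation cube := {ffun 'I_d -> bool}.

Definition corner (e : cube) : 'rV[int]_d := \sum_(i | e i) bv i.
Definition flip i (e : cube) : cube := [ffun k => if k == i then ~~ e k else e k].

Lemma flipK i : involutive (flip i).
Proof. by move=> e; apply/ffunP => k; rewrite !ffunE; case: eqP => // _; rewrite negbK. Qed.

Lemma corner_flip i (e : cube) : e i -> corner e = bv i + corner (flip i e).
Proof.
move=> ei; rewrite /corner (bigD1 i) //=; congr (_ + _); apply: eq_bigl => k.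
by rewrite ffunE; case: eqP => [->|]; rewrite ?ei ?andbT // andbF.
Qed.

Lemma shift2 i (v : fn F d) : shift (bv i) (shift (bv i) v) = shift (bv i) (wd i v) + v.
Proof. by rewrite -wd_shift /wd [in X in _ - X]shiftD addNr shift0 subrK. Qed.

(** The relation [T_i ^ 2 = w_i T_i + 1] of [shift2] brings every exponent
    down to 0 or 1 and raises the degree in the [w_i] by at most one per
    translation. *)
Lemma translate_corners s : exists P : cube -> {mpoly F[d]},
  (forall e, (msize (P e) <= (size s).+1)%N) /\
  shift (\sum_(i <- s) bv i) u = \sum_e shift (corner e) (actw (P e) u).
Proof.
elim: s => [|i s [P [sP hP]]].
  exists (fun e => (e == [ffun=> false])%:R); split=> [e|].
    by case: eqP; rewrite ?msize1 ?mmeasure0.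
  rewrite big_nil (bigD1 [ffun=> false]) //= big1 => [|e /negbTE->];
    last by rewrite act0l linear0.
  rewrite eqxx (act1 wdC) addr0; congr (shift _ u).
  by rewrite /corner big1 // => i; rewrite ffunE.
exists (fun e => P (flip i e) + (if e i then 'X_i * P e else 0)); split=> [e|].
  apply: leq_trans (mmeasureD_le _ _ _) _; rewrite geq_max /= (leq_trans (sP _)) //=.
  case: ifP => _; last by rewrite mmeasure0.
  have [->|P0] := eqVneq (P e) 0; first by rewrite mulr0 mmeasure0.
  have X0 : 'X_i != 0 :> {mpoly F[d]} by rewrite -(mmeasure_poly_eq0 mdeg) (msizeX _ _)
    mdeg1.
  by rewrite msizeM // msizeX mdeg1 ltnS; have := sP e.
rewrite big_cons -shiftD hP linear_sum /=.
under [RHS]eq_bigr => e _ do rewrite actDl linearD /=.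
rewrite big_split /= [X in _ = X + _](reindex_inj (inv_inj (flipK i))) /= -big_split /=.
apply: eq_bigr => e _; rewrite flipK.
have [ei|ei] := boolP (e i).
  rewrite (corner_flip ei) (actM wdC) (act_var wdC) -!shiftD.
  by rewrite shift2 addrC wd_shift.
rewrite act0l linear0 addr0 (@corner_flip i (flip i e)) ?flipK ?shiftD //.
by rewrite ffunE eqxx.
Qed.

Lemma inQ_corner e : inQ 1 (corner e).
Proof.
apply/forallP => k; rewrite /corner summxE.
have [ek|ek] := boolP (e k).
  rewrite (bigD1 k) //= big1 => [|i /andP[_ ik]]; first by rewrite mxE !eqxx addr0.
  by rewrite mxE eq_sym (negbTE ik) andbF.
rewrite big1 => [|i ei]; first by rewrite normr0.
by rewrite mxE eqxx; case: eqP => // ki; move: ek; rewrite ki ei.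
Qed.

Variables (j m : nat).
Hypothesis mn : (m < n)%N.
Notation obs := (limg (linfun (@observe F d n u j m.+1))).

Definition cornermap e := linfun (restr n m \o (shift (corner e) \o @ext F d n)).
Definition transpan : {vspace bfun F d n} := (\sum_e cornermap e @: obs)%VS.

Lemma dim_transpan : (\dim transpan <= 2 ^ d * \dim obs)%N.
Proof.
apply: leq_trans (dimv_leq_sum _ _ _) _.
apply: leq_trans (_ : \sum_(e : cube) \dim obs <= _)%N.
  by apply: leq_sum => e _; rewrite -[X in (_ <= X)%N](limg_ker_dim (cornermap e)) leq_addl.
by rewrite sum_nat_const card_ffun card_bool card_ord.
Qed.

Lemma mem_transpan s : (size s <= j)%N ->
  restr n m (shift (\sum_(i <- s) bv i) u) \in transpan.
Proof.
move=> sj; have [P [sP ->]] := translate_corners s.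
rewrite linear_sum; apply: rpred_sum => e _.
apply: (subvP (sumv_sup e _ (subvv _))) => //=.
have -> : restr n m (shift (corner e) (actw (P e) u)) =
  cornermap e (observe n u m.+1 (tr j (P e))).
  rewrite lfunE /= /observe; set q := emb _.
  have -> : q = P e.
    apply/esym/eqP; rewrite -subr_eq0; apply/eqP/mpolyP => k; rewrite mcoeff0.
    have [kj|kj] := ltnP (mdeg k) j.+1; first exact: emb_tr.
    rewrite mcoeffB mcoeff_emb_high // subr0; apply/memN_msupp_eq0/msize_mdeg_ge.
    by apply: leq_trans (sP e) _; apply: leq_trans kj.
  rewrite (@restr_local _ _ _ (shift (corner e))) //; first exact: ltnW.
  by move=> w wv; apply: (@van_shift _ _ _ 1); rewrite ?inQ_corner ?addn1.
by apply/memv_img; rewrite -[X in X \in _](lfunE (observe n u m.+1)) memv_img ?memvf.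
Qed.

Variable b : nat.
Hypotheses (bm : (b <= m)%N) (mbn : (m + b <= n)%N) (bj : (d * b <= j)%N).
Hypothesis u0 : u 0 != 0.

(** As [u 0 != 0], every translate of [u] by a vector [a] of the cube is
    nonzero in the box of radius [m], hence at some point [e] of a determining
    set. Then [e + a] lies in the support of [u], and the two points give back
    [a]. *)
Theorem uncertainty : (b.+1 ^ d <= #|supp_box n u| * (2 ^ d * \dim obs))%N.
Proof.
have [E [cE hE]] := determining_set transpan.
pose A := {ffun 'I_d -> 'I_b.+1}.
pose va (a : A) : 'rV[int]_d := \row_i (a i : nat)%:Z.
have va_inj : injective va.
  move=> a a' /rowP h; apply/ffunP => i; apply: val_inj.
  by have := h i; rewrite !mxE => -[].
have vaQ a : inQ b (va a).
  by apply/forallP => i; rewrite mxE; have := ltn_ord (a i); lia.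
have hit a : exists ec : box d n * box d n,
    [&& ec.1 \in E, ec.2 \in supp_box n u & pt ec.2 == pt ec.1 + va a].
  pose mm : 'X_{1..d} := [multinom (a i : nat) | i < d].
  have Eva : \sum_(i <- word mm) bv i = va a.
    rewrite /word big_flatten big_map big_enum /=.
    under eq_bigr => i _ do rewrite big_nseq iter_addr_0 mnmE -scaler_nat.
    apply/rowP => k; rewrite summxE !mxE (bigD1 k) //= big1 => [|i ik].
      by rewrite !mxE !eqxx mulr1 addr0 natz.
    by rewrite !mxE eq_sym (negbTE ik) andbF mulr0.
  have sj : (size (word mm) <= j)%N.
    rewrite size_word mdegE; apply: leq_trans bj.
    rewrite -[d in (d * b)%N]card_ord -sum_nat_const; apply: leq_sum => i _.
    by rewrite mnmE -ltnS.
  have := mem_transpan sj; rewrite Eva => phiW.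
  have mn' : (m <= n)%N by exact: ltnW.
  have [[e eE]|no] := pselect (exists2 e, e \in E & restr n m (shift (va a) u) e != 0).
    rewrite ffunE; case: ifP => [em ue|]; last by rewrite eqxx.
    have [c cP] : exists c : box d n, pt c = pt e + va a.
      by apply: ptP; apply: inQW (inQD em (vaQ a)).
    by exists (e, c); rewrite /= eE inE cP eqxx /= andbT.
  have : restr n m (shift (va a) u) = 0.
    by apply: hE => // e eE; apply/eqP; apply: contra_notT no => h; exists e.
  move/(restr_eq0 _ mn')/(_ (- va a)); rewrite inQN /shift addNr => h.
  by move: u0; rewrite h ?eqxx //; apply: inQW (vaQ a).
have [g gP] := choice hit.
have g_inj : injective g.
  move=> a a' E1; apply: va_inj; have /and3P[_ _ /eqP h1] := gP a.
  have /and3P[_ _ /eqP h2] := gP a'; move: h1; rewrite E1 h2.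
  by move/addrI.
have -> : (b.+1 ^ d = #|[set: A]|)%N by rewrite cardsT card_ffun !card_ord.
rewrite -(card_imset _ g_inj).
apply: leq_trans (_ : #|finset.setX E (supp_box n u)| <= _)%N.
  apply/subset_leq_card/fintype.subsetP => x /imsetP[a _ ->].
  by have /and3P[h1 h2 _] := gP a; rewrite inE h1 h2.
rewrite cardsX mulnC leq_mul2l; apply/orP; right.
exact: leq_trans cE dim_transpan.
Qed.
End Translates.

(** * The lower bound through codimensions *)

Local Open Scope nat_scope.
Lemma sum_shift_le (g : nat -> nat) N a l k : (forall m,
  m <= a + l + k -> \sum_(i < m) g i <= N) ->
  \sum_(i < l) g (a + i + k) <= N.
Proof.
move=> h; apply: leq_trans (h (a + l + k) (leqnn _)).
have -> : \sum_(i < l) g (a + i + k) = \sum_(a + k <= i < a + l + k) g i.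
  rewrite -{1}[a + k]add0n (_ : a + l + k = l + (a + k)); last lia.
  rewrite big_addn addnK big_mkord; apply: eq_bigr => i _; congr g; lia.
rewrite -(big_mkord xpredT g) [X in _ <= X](@big_cat_nat _ _ _ (a + k)) //=; last lia.
exact: leq_addl.
Qed.

(** An average over the [l] windows that start in the range: every value of
    [g] lies in at most [c] of them. *)
Lemma sparse_window (g : nat -> nat) N c l : 0 < l ->
  (forall m, m <= 2 * l + c -> \sum_(i < m) g i <= N) ->
  exists2 j, l <= j < 2 * l & l * \sum_(k < c) g (j.+1 + k) <= c * N.
Proof.
move=> l0 h; pose W j := \sum_(k < c) g (j.+1 + k).
have tot : \sum_(i < l) W (l + i) <= c * N.
  rewrite /W exchange_big /= -[c in c * N]card_ord -sum_nat_const; apply: leq_sum => k _.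
  have := @sum_shift_le g N l.+1 l k.
  under eq_bigr => i _ do rewrite addSn; apply.
  by move=> m mk; apply: h; have := ltn_ord k; lia.
have [i _ hi] : exists2 i : 'I_l, true & l * W (l + i) <= c * N.
  apply/exists2P; apply: contrapT => /forallNP no.
  have : l * (c * N).+1 <= l * \sum_(i < l) W (l + i).
    rewrite big_distrr /= -[l in l * _]card_ord -sum_nat_const; apply: leq_sum => i _.
    by rewrite ltnNge; apply/negP => hi; apply: (no i).
  by rewrite leq_pmul2l // ltnNge tot.
by exists (l + i) => //; have := ltn_ord i; lia.
Qed.

Lemma leq_pow2r a b k : a <= b -> a ^ k <= b ^ k.
Proof. by case: k => // k ab; rewrite leq_exp2r. Qed.

Section Bound.
Variables (F : numFieldType) (d : nat).
Hypothesis d0 : 0 < d.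
Let c := msize (relpoly F d).

Lemma supp_gt0 n (u : fn F d) : (u 0 != 0)%R -> 0 < #|supp_box n u|.
Proof.
move=> u0; have [b bE] := @ptP d n 0%R (inQ0 _ _).
by apply/card_gt0P; exists b; rewrite inE bE.
Qed.

(** In [uncertainty] the dimension is at most [D1 + w], with [w] the sum over
    the window. If [D1] dominates, then [x ^ d <= C N D1] with [D1 ^ d <= C N
    ^ (d - 1)]. If [w] dominates, then [x ^ d.+1 <= C N ^ 2], which is
    stronger because [2 d^2 <= (d + 1) (2 d - 1)]. *)
Theorem support_bound : exists2 C, 0 < C & forall n (u : fn F d),
  lap u = 0%R -> (u 0 != 0)%R -> n ^ (d * d) <= C * #|supp_box n u| ^ (2 * d).-1.
Proof.
pose A := 2 ^ 'C(d, 2) * (2 * d) ^ d.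
pose C1 := 2 ^ (d.+1 * d) * A; pose C2 := 2 ^ d.+1 * (2 * c).
pose C3 := C1 + C2 ^ (2 * d).-1.
(* For n > n0 the degrees up to 2 d b, the window after them and the boxes of
   radius b fit into the box of radius n, where b is about n / (4 d). *)
pose n0 := 4 * d + 4 * c.+1.
exists (n0 ^ (d * d) + (4 * d) ^ (d * d) * C3).
  by rewrite addn_gt0 expn_gt0 /n0 addnS.
move=> n u lap_u u0; set N := #|_|; have N0 : 0 < N by apply: supp_gt0.
have Np k : 0 < N ^ k by rewrite expn_gt0 N0.
rewrite mulnDl; have [nn0|nn0] := leqP n n0.
  by apply: leq_trans (leq_addr _ _); apply: leq_trans (leq_pmulr _ _) => //;
    rewrite leq_exp2r // muln_gt0 d0.
apply: leq_trans (leq_addl _ _).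
pose b := n %/ (4 * d); set x := b.+1.
have nx : n <= 4 * d * x by rewrite mulnC ltnW // ltn_ceil // muln_gt0.
have bn : 4 * (d * b) <= n by rewrite mulnA mulnC leq_trunc_div.
have b0 : 0 < b by rewrite divn_gt0 ?muln_gt0 //; lia.
have bdb : b <= d * b by rewrite leq_pmull.
suff hx : x ^ (d * d) <= C3 * N ^ (2 * d).-1.
  rewrite -mulnA; apply: leq_trans (_ : (4 * d * x) ^ (d * d) <= _).
    by rewrite leq_exp2r // muln_gt0 d0.
  by rewrite expnMn leq_mul2l hx orbT.
have [|m hm|j /andP[j1 j2] win] := @sparse_window (gdim n u) N c (d * b);
  first by rewrite muln_gt0 d0.
  by apply: sum_gdim => //; lia.
have jn : j <= n by lia.
have := @uncertainty F d n u j b _ b (leqnn b) _ j1 u0.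
set Dim := \dim _; move=> unc.
have {unc} : x ^ d <= N * (2 ^ d * Dim) by apply: unc; lia.
have : Dim <= _ := @dim_observe F d n u lap_u j b.+1 _.
rewrite -/c => dimO unc.
have {dimO} := dimO _; set D1 := codim _; set w := \sum_(k < c) _ => dimO.
have {}dimO : Dim <= D1 + w by apply: dimO; lia.
have hD1 : D1 ^ d <= A * N ^ d.-1.
  apply: leq_trans (codim_relpoly (@relspace_dil F d n u j) (relspace_ideal u jn)
    (relspace_proper n j u0) d0) _.
  rewrite mulnAC leq_mul2l; apply/orP; right.
  apply: leq_pow2r; apply: leq_trans (codim_relspace n u j) _.
  exact: sum_gdim.
rewrite -/w in win; move: hD1 unc dimO win Np N0 nx j1 b0; rewrite /C3 /C1 /C2;
  clear C3 C1 C2.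
move: (D1) (w) (Dim) (A) => {}D1 {}w {}Dim {}A.
clear -d0; move=> hD1 unc dimO win Np N0 nx j1 b0.
have [wD|Dw] := leqP w D1.
  have h1 : x ^ d <= N * 2 ^ d.+1 * D1.
    apply: leq_trans unc _; rewrite -mulnA leq_mul2l expnS; apply/orP; right.
    have := leq_mul (leqnn (2 ^ d)) (leq_trans dimO (leq_add (leqnn D1) wD)).
    by move/leq_trans; apply; rewrite addnn -mul2n mulnCA mulnA.
  rewrite mulnDl; apply: leq_trans (leq_addr _ _); rewrite expnM.
  apply: leq_trans (_ : (N * 2 ^ d.+1 * D1) ^ d <= _); first by rewrite leq_exp2r.
  rewrite !expnMn -expnM mulnAC [_ * 2 ^ _]mulnC -!mulnA.
  rewrite [X in _ <= X](_ : _ = 2 ^ (d.+1 * d) * (N ^ d * (A * N ^ d.-1))); last first.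
    have -> : (2 * d).-1 = d + d.-1 by lia.
    by rewrite expnD; ring.
  by rewrite leq_mul2l leq_mul2l hD1 !orbT.
have h1 : x ^ d.+1 <= 2 ^ d.+1 * (2 * c) * N ^ 2.
  have h2 : x ^ d <= N * 2 ^ d.+1 * w.
    apply: leq_trans unc _; rewrite -mulnA leq_mul2l expnS; apply/orP; right.
    have := leq_mul (leqnn (2 ^ d)) (leq_trans dimO (leq_add (ltnW Dw) (leqnn w))).
    by move/leq_trans; apply; rewrite addnn -mul2n mulnCA mulnA.
  have xl : x <= 2 * (d * b) by rewrite /x; nia.
  have h3 : x * w <= 2 * (c * N).
    apply: leq_trans (leq_mul xl (leqnn w)) _.
    by rewrite -mulnA leq_mul2l win orbT.
  rewrite expnS; apply: leq_trans (leq_mul (leqnn x) h2) _.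
  rewrite (_ : x * _ = N * 2 ^ d.+1 * (x * w)); last by ring.
  apply: leq_trans (leq_mul (leqnn _) h3) _.
  by apply: eq_leq; ring.
rewrite mulnDl; apply: leq_trans (leq_addl _ _).
rewrite -(@leq_exp2r _ _ 2) // -!expnM -expnMn -expnM.
have -> : (2 ^ d.+1 * (2 * c) * N) ^ ((2 * d).-1 * 2)
  = (2 ^ d.+1 * (2 * c)) ^ (2 * d).-1 * ((2 ^ d.+1 * (2 * c) * N ^ 2) ^ (2 * d).-1).
  move: (2 ^ d.+1 * (2 * c)) => K0.
  by rewrite [X in _ ^ X = _]mulnC expnM -expnMn; congr (_ ^ _); ring.
have x0 : 0 < x by [].
apply: leq_trans (_ : (2 ^ d.+1 * (2 * c) * N ^ 2) ^ (2 * d).-1 <= _); last first.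
  apply: leq_pmull; rewrite expn_gt0; apply/orP; left.
  move: h1; case: (2 ^ d.+1 * (2 * c)) => //; rewrite mul0n leqn0 => /eqP h.
  by have := expn_gt0 x d.+1; rewrite h.
apply: leq_trans (_ : (x ^ d.+1) ^ (2 * d).-1 <= _); last by rewrite leq_exp2r //; lia.
by rewrite -expnM leq_pexp2l //; nia.
Qed.
End Bound.
Local Close Scope nat_scope.

End PolynomialMethod.
Import PolynomialMethod.

(** * Functions that are polynomial on an interval *)

Section Antidiff.
Variable F : numFieldType.
Implicit Types (p q : {poly F}) (f g : int -> F) (a b : int).

(** The difference of a falling factorial is a multiple of the preceding one. *)
Lemma antidifference n q : (size q <= n)%N ->
  exists2 p : {poly F}, (size p <= n.+1)%N & forall x, p.[x + 1] - p.[x] = q.[x].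
Proof.
pose B m : {poly F} := \prod_(l < m) ('X - l%:R%:P).
have sB m : size (B m) = m.+1 by rewrite size_prod_XsubC /index_enum -enumT size_enum_ord.
have mB m : B m \is monic by apply: monic_prod_XsubC.
have dB m x : (B m.+1).[x + 1] - (B m.+1).[x] = m.+1%:R * (B m).[x].
  have E1 : (B m.+1).[x + 1] = (x + 1) * (B m).[x].
    rewrite /B big_ord_recl hornerM; congr (_ * _); first by rewrite !hornerE subr0.
    rewrite !horner_prod; apply: eq_bigr => l _; rewrite !hornerE /= /bump /= natrD; ring.
  rewrite E1 {2}/B big_ord_recr hornerM -/(B m) !hornerE -natr1; ring.
elim: n q => [|n IH] q sq.
  move: sq; rewrite leqn0 size_poly_eq0 => /eqP ->; exists 0; first by rewrite size_poly0.
  by move=> x; rewrite !horner0 subrr.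
have [|p sp hp] := IH (q - q`_n *: B n).
  apply/leq_sizeP => k; rewrite leq_eqVlt => /predU1P[<-|nk].
    rewrite coefB coefZ; have := mB n; rewrite monicE /lead_coef sB /= => /eqP ->.
    by rewrite mulr1 subrr.
  have h (r : {poly F}) : (size r <= n.+1)%N -> r`_k = 0 by move/leq_sizeP; apply.
  by rewrite coefB coefZ !h ?sB // mulr0 subrr.
exists (p + (q`_n / n.+1%:R) *: B n.+1).
  apply: leq_trans (size_polyD _ _) _; rewrite geq_max (leq_trans sp) //=.
  by apply: leq_trans (size_scale_leq _ _) _; rewrite sB.
move=> x; rewrite !hornerD !hornerZ opprD addrACA hp -mulrBr dB hornerD hornerN hornerZ.
by rewrite mulrA divfK ?pnatr_eq0 // subrK.
Qed.

Definition polyon n a b f :=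
  exists2 p : {poly F}, (size p <= n)%N & forall x, a <= x <= b -> f x = p.[x%:~R].

Lemma polyon_ext n a b f g : (forall x, a <= x <= b -> f x = g x) ->
  polyon n a b f -> polyon n a b g.
Proof. by move=> h [p sp hp]; exists p => // x xab; rewrite -h // hp. Qed.

Lemma polyonW n n' a a' b b' f : (n <= n')%N -> a <= a' -> b' <= b ->
  polyon n a b f -> polyon n' a' b' f.
Proof.
move=> nn aa bb [p sp hp]; exists p; first exact: leq_trans sp nn.
by move=> x /andP[x1 x2]; apply: hp; rewrite (le_trans aa x1) (le_trans x2 bb).
Qed.

Lemma polyonD n a b f g : polyon n a b f -> polyon n a b g ->
  polyon n a b (fun x => f x + g x).
Proof.
move=> [p sp hp] [q sq hq]; exists (p + q).
  by apply: leq_trans (size_polyD _ _) _; rewrite geq_max sp.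
by move=> x xab; rewrite hornerD hp // hq.
Qed.

Lemma polyonZ n a b f c : polyon n a b f -> polyon n a b (fun x => c * f x).
Proof.
move=> [p sp hp]; exists (c *: p); first by apply: leq_trans (size_scale_leq _ _) sp.
by move=> x xab; rewrite hornerZ hp.
Qed.

Lemma polyon_shift n a b f : polyon n a b f ->
  polyon n (a + 1) (b + 1) (fun x => f (x - 1)).
Proof.
move=> [p sp hp]; exists (p \Po ('X - 1%:P)).
  have [->|p0] := eqVneq p 0; first by rewrite comp_poly0 size_poly0.
  by rewrite size_comp_poly2 ?size_XsubC.
move=> x xab; rewrite horner_comp !hornerE hp; last lia.
by rewrite intrD.
Qed.

Lemma polyon_antidiff n a b f : polyon n a (b - 1) (fun x => f (x + 1) - f x) ->
  polyon n.+1 a b f.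
Proof.
move=> [q sq hq]; have [p sp hp] := antidifference sq.
exists (p + (f a - p.[a%:~R])%:P).
  apply: leq_trans (size_polyD _ _) _; rewrite geq_max sp /=.
  by apply: leq_trans (size_polyC_leq1 _) _.
suff E (m : nat) : a + m%:Z <= b ->
  f (a + m%:Z) = (p + (f a - p.[a%:~R])%:P).[(a + m%:Z)%:~R].
  move=> x /andP[x1 x2]; have := E `|x - a|%N.
  have -> : a + `|x - a|%N = x by lia.
  by apply.
elim: m => [|m IH] mb; first by rewrite addr0 hornerD hornerC addrC subrK.
have mab : a <= a + m%:Z <= b - 1 by lia.
have := hq _ mab; rewrite -hp IH; last lia.
have -> : a + m.+1%:Z = a + m%:Z + 1 by lia.
move=> /eqP; rewrite subr_eq => /eqP ->;
  rewrite !hornerD !hornerC [(_ + _ + 1)%:~R]intrD; ring.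
Qed.

(** A nonzero polynomial has fewer roots than its size. *)
Lemma polyon_support n a b f x : polyon n a b f -> a <= x <= b -> f x != 0 ->
  exists s : seq int, [/\ uniq s, all (fun y => [&& a <= y, y <= b & f y != 0]) s
    & ((b - a + 1) <= (size s + n.-1)%:Z)].
Proof.
move=> [p sp hp] xab fx; have p0 : p != 0.
  by apply: contraNneq fx => p0; rewrite hp // p0 horner0.
pose r := [seq a + i%:Z | i <- iota 0 (absz (b - a + 1)%R)].
have ur : uniq r by rewrite map_inj_uniq ?iota_uniq // => i k /addrI [].
have rE y : (y \in r) = (a <= y <= b).
  apply/mapP/idP => [[i]|yab].
    rewrite mem_iota => /andP[_ ib] ->; lia.
  by exists `|y - a|%N; [rewrite mem_iota; lia|lia].
exists [seq y <- r | f y != 0]; split; first exact: filter_uniq.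
  by apply/allP => y; rewrite mem_filter rE => /andP[-> /andP[-> ->]].
pose z := [seq (y%:~R : F) | y <- r & f y == 0].
have zn : (size z < n)%N.
  apply: leq_trans sp; apply: max_poly_roots => //.
    apply/allP => t /mapP[y]; rewrite mem_filter rE => /andP[/eqP fy yab] ->{t}.
    by rewrite /root -hp // fy.
  by rewrite map_inj_uniq ?filter_uniq // => y y' /intr_inj.
have sr : (size r = size [seq y <- r | f y != 0%R] + size z)%N.
  by rewrite -(count_predC (fun y => f y == 0) r) addnC size_map !size_filter.
have : size r = (absz (b - a + 1)%R) by rewrite size_map size_iota.
by rewrite sr; lia.
Qed.
End Antidiff.

(** * Octahedra in dimension three *)

Section Tilted.
Variable F : numFieldType.
Notation fn3 := (int -> int -> int -> F).
Implicit Types (v : fn3) (x y z : int).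

(** Harmonicity of [v] multiplied by [(-1) ^ x]. The signs turn the sum of two
    neighbours on a layer [x + y = const] into a difference. *)
Definition tilted v := forall x y z,
  v x (y + 1) z + v x (y - 1) z + (v x y (z + 1) + v x y (z - 1))
    - v (x + 1) y z - v (x - 1) y z = 6%:R * v x y z.

Definition reflect3 (s : int * int * int) v : fn3 :=
  fun x y z => v (s.1.1 * x) (s.1.2 * y) (s.2 * z).

Definition is_sign (s : int) := (s == 1) || (s == -1).

Lemma tilted_reflect s v : is_sign s.1.1 -> is_sign s.1.2 -> is_sign s.2 ->
  tilted v -> tilted (reflect3 s v).
Proof.
case: s => [[a b] c] /= ha hb hc hv x y z; rewrite -hv /reflect3 /= !mulrDr !mulrN !mulr1.
have -> : v (a * x) (b * y + b) (c * z) + v (a * x) (b * y - b) (c * z)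
  = v (a * x) (b * y + 1) (c * z) + v (a * x) (b * y - 1) (c * z).
  by case/orP: hb => /eqP ->; rewrite ?opprK // addrC.
have -> : v (a * x) (b * y) (c * z + c) + v (a * x) (b * y) (c * z - c)
  = v (a * x) (b * y) (c * z + 1) + v (a * x) (b * y) (c * z - 1).
  by case/orP: hc => /eqP ->; rewrite ?opprK // addrC.
case/orP: ha => /eqP -> //; rewrite opprK; ring.
Qed.

Section Core.
Variables (v : fn3) (r : nat) (R : int).
Hypothesis v_tilted : tilted v.
Hypothesis van : forall x y z, `|x| + `|y| < r%:Z -> `|x| + `|y| + `|z| <= R -> v x y z = 0.

Lemma layer_step x y z : v x (y + 1) z - v (x + 1) y z =
  6%:R * v x y z - (v x y (z + 1) + v x y (z - 1)) - v x (y - 1) z + v (x - 1) y z.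
Proof. rewrite -v_tilted; ring. Qed.

(** Two consecutive layers below the distance [r] vanish, and the equation
    expresses the differences along a layer through the two layers before it,
    so that the degree grows by at most one per layer. *)
Lemma layer_poly i z : `|z| + (r%:Z - 2) + i%:Z <= R ->
  polyon i.-1 i%:Z (r%:Z - 2) (fun x => v x (r%:Z - 2 + i%:Z - x) z).
Proof.
pose S k := forall z, `|z| + (r%:Z - 2) + k%:Z <= R ->
  polyon k.-1 k%:Z (r%:Z - 2) (fun x => v x (r%:Z - 2 + k%:Z - x) z).
suff H : S i /\ S i.+1 by case: H => + _; apply.
have S01 k : (k <= 1)%N -> S k.
  move=> k1 t ht; exists 0; first by rewrite size_poly0.
  by move=> x xab; rewrite horner0; apply: van; lia.
elim: {z} i => [|i [IH0 IH1]]; first by split; apply: S01.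
split=> // z hz; apply: polyon_antidiff.
have P0 := IH1 z ltac:(lia); have P1 := IH1 (z + 1) ltac:(lia);
  have P2 := IH1 (z - 1) ltac:(lia).
have P3 := IH0 z ltac:(lia).
have Q0 : polyon i i.+2%:Z (r%:Z - 2 - 1) (fun x => v (x - 1) (r%:Z - 1 + i%:Z - x) z).
  apply: (@polyonW _ i.-1 _ (i%:Z + 1) _ (r%:Z - 2 + 1)); [lia|lia|lia|].
  apply: polyon_ext (polyon_shift P3) => x _ /=; congr (v _ _ _); lia.
have W k (f : int -> F) : (k <= i)%N -> polyon k i.+1%:Z (r%:Z - 2) f ->
    polyon i i.+2%:Z (r%:Z - 2 - 1) f.
  by move=> ki; apply: polyonW; [|lia|lia].
have W' (f : int -> F) : polyon i.-1 i%:Z (r%:Z - 2) f -> polyon i i.+2%:Z (r%:Z - 2 - 1) f.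
  by apply: polyonW; lia.
have T := polyonD (polyonD (polyonZ (- 6%:R) (W _ _ (leqnn i) P0))
   (polyonD (W _ _ (leqnn i) P1) (W _ _ (leqnn i) P2)))
   (polyonD (W' _ P3) (polyonZ (-1) Q0)).
apply: polyon_ext T => x xab /=.
have := layer_step x (r%:Z - 1 + i%:Z - x) z.
have -> : r%:Z - 1 + i%:Z - x + 1 = r%:Z - 2 + i.+2%:Z - x by lia.
have -> : r%:Z - 1 + i%:Z - x - 1 = r%:Z - 2 + i%:Z - x by lia.
have -> : r%:Z - 2 + i.+1%:Z - x = r%:Z - 1 + i%:Z - x by lia.
have -> : r%:Z - 2 + i.+2%:Z - (x + 1) = r%:Z - 1 + i%:Z - x by lia.
move=> h; rewrite -[RHS]opprB h; ring.
Qed.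

Lemma first_layer_const x z : 1 <= x -> x <= r%:Z - 2 -> `|z| + r%:Z <= R ->
  v (x + 1) (r%:Z - 1 - x) z = v x (r%:Z - x) z.
Proof.
move=> x1 x2 hz; have := layer_step x (r%:Z - 1 - x) z.
rewrite [X in _ = X -> _](_ : _ = 0); last by rewrite !van; try lia; ring.
have -> : r%:Z - 1 - x + 1 = r%:Z - x by lia.
by move=> /eqP; rewrite subr_eq0 => /eqP.
Qed.

Lemma first_layer x x' z : 1 <= x -> x <= x' -> x' <= r%:Z - 1 -> `|z| + r%:Z <= R ->
  v x' (r%:Z - x') z = v x (r%:Z - x) z.
Proof.
move=> x1 xx x2 hz.
suff E (m : nat) : x + m%:Z <= r%:Z - 1 ->
  v (x + m%:Z) (r%:Z - (x + m%:Z)) z = v x (r%:Z - x) z.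
  have -> : x' = x + (absz (x' - x)%R) by lia.
  by apply: E; lia.
elim: m => [|m IH] mr; first by rewrite addr0.
rewrite -IH; last lia.
rewrite -(@first_layer_const (x + m%:Z) z); [|lia|lia|lia].
by congr (v _ _ _); lia.
Qed.

(** By [layer_poly] the rows up to the layer [r + h] are polynomials of degree
    at most [h], so that one nonzero value leaves at most [h] zeros. *)
Lemma row_support h x y z : v x y z != 0 -> h%:Z + 2 <= x -> x <= r%:Z - 2 -> 0 <= y ->
  x + y <= r%:Z + h%:Z -> x + y + `|z| <= R ->
  exists s : seq (int * int * int), [/\ uniq s,
    all (fun p : int * int * int => [&& p.2 == z, v p.1.1 p.1.2 p.2 != 0, 0 <= p.1.1 <= r%:Z
           & 0 <= p.1.2 <= r%:Z + h%:Z]) s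
    & r%:Z - 3 - 2 * h%:Z <= (size s)%:Z].
Proof.
move=> v0 hx xr y0 xyr xyz.
have rxy : r%:Z <= x + y.
  by rewrite leNgt; apply: contraNN v0 => xyr'; rewrite van //; lia.
pose i := absz (x + y - r%:Z + 2)%R; have iE : i%:Z = x + y - r%:Z + 2 by rewrite /i; lia.
have P : polyon i.-1 i%:Z (r%:Z - 2) (fun x => v x (r%:Z - 2 + i%:Z - x) z).
  by apply: layer_poly; lia.
have yE : r%:Z - 2 + i%:Z - x = y by lia.
have [|| s [us sP ss]] := @polyon_support _ _ _ _ _ x P; [lia|by rewrite yE|].
exists [seq (x', r%:Z - 2 + i%:Z - x', z) | x' <- s]; split.
- by rewrite map_inj_uniq // => a b [].
- rewrite all_map; apply: sub_all sP => t /and3P[t1 t2 t3] /=; rewrite eqxx t3 /=; lia.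
- by rewrite size_map; lia.
Qed.

(** Otherwise the equation at the point below [(x, y, z)] has a single nonzero
    term. *)
Lemma descend x y z : v x y z != 0 -> exists x' y' z',
  [/\ v x' y' z' != 0, `|x' - x| + `|y' - y| <= 1 & z - 2 <= z' <= z - 1].
Proof.
move=> v0.
pose cand := [:: (x, y, z - 1); (x, y, z - 1 - 1); (x + 1, y, z - 1); (x - 1, y, z - 1);
               (x, y + 1, z - 1); (x, y - 1, z - 1)].
have [/hasP[p pc pv]|/hasPn no] := boolP (has (fun p => v p.1.1 p.1.2 p.2 != 0) cand).
  exists p.1.1, p.1.2, p.2; split=> //; move: pc; rewrite !inE;
    by do ![case/predU1P=> [->|]] => /=; try lia; move=> /eqP -> /=; lia.
have vz p : p \in cand -> v p.1.1 p.1.2 p.2 = 0 by move/no; rewrite negbK => /eqP.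
have := v_tilted x y (z - 1); rewrite subrK.
have := vz (x, y, z - 1); have := vz (x, y, z - 1 - 1); have := vz (x + 1, y, z - 1).
have := vz (x - 1, y, z - 1); have := vz (x, y + 1, z - 1); have := vz (x, y - 1, z - 1).
rewrite !inE !eqxx !orbT /= => -> // -> // -> // -> // -> // -> // /eqP.
by rewrite !(addr0, add0r, subr0, mulr0) (negbTE v0).
Qed.

Variables (M : nat) (x0 y0 z0 : int).
Hypotheses (xy0 : x0 + y0 = r%:Z) (x0M : 2 * M%:Z + 2 <= x0) (x0r : x0 + M%:Z + 2 <= r%:Z)
  (z00 : 0 <= z0) (rz0 : r%:Z + z0 <= R) (rM : r%:Z + 3 * M%:Z <= R).

Definition near_point (p : int * int * int) :=
  [&& v p.1.1 p.1.2 p.2 != 0, 0 <= p.1.1 <= r%:Z, 0 <= p.1.2 <= r%:Z + M%:Z & `|p.2| <= R].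

(** Repeated use of [descend] meets nonzero values at pairwise different
    heights. A step changes the layer and the position along the layer by at
    most one, so that [row_support] applies at each height. *)
Lemma chain_support m h x y z : (h + m <= M)%N -> v x y z != 0 ->
  `|x - x0| <= h%:Z -> `|y - y0| <= h%:Z -> `|x + y - r%:Z| <= h%:Z ->
  - (2 * h%:Z) <= z -> z <= z0 - h%:Z ->
  exists s : seq (int * int * int), [/\ uniq s,
    all (fun p : int * int * int => (p.2 <= z) && near_point p) s
    & m.+1%:Z * (r%:Z - 3 - 2 * M%:Z) <= (size s)%:Z].
Proof.
elim: m h x y z => [|m IH] h x y z hm v0 hx hy hxy z1 z2;
  have [|||||s [us sP ss]] := @row_support h x y z v0; try lia.
  exists s; split=> //; last by lia.
  apply: sub_all sP => p /and4P[/eqP pz pv p1 p2]; rewrite /near_point pv p1 pz lexx /=;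
    lia.
have [x' [y' [z' [v0' d z'z]]]] := descend v0.
have [||||||s' [us' sP' ss']] := IH h.+1 x' y' z' _ v0'; try lia.
exists (s ++ s'); split.
- rewrite cat_uniq us us' andbT /=; apply/hasPn => p /(allP sP')/andP[pz' _].
  by apply/negP => /(allP sP)/and4P[/eqP pz _ _ _]; lia.
- rewrite all_cat; apply/andP; split.
    apply: sub_all sP => p /and4P[/eqP pz pv p1 p2];
      rewrite /near_point pv p1 pz lexx /=; lia.
  by apply: sub_all sP' => p /andP[pz ->]; rewrite andbT; lia.
- rewrite size_cat PoszD [m.+2%:Z](_ : _ = 1 + m.+1%:Z) // mulrDl mul1r.
  by apply: lerD ss'; lia.
Qed.
End Core.

(** The lowest nonzero layer is constant along the open face, so that the
    descent can start in the middle of the face, far from the ends of the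
    rows. *)
Lemma face_support v (r : nat) (R : int) x z : tilted v ->
  (forall x y z, `|x| + `|y| < r%:Z -> `|x| + `|y| + `|z| <= R -> v x y z = 0) ->
  (16 <= r)%N -> 4 * r%:Z <= R -> 0 <= z -> r%:Z + z <= R -> 1 <= x -> x <= r%:Z - 1 ->
  v x (r%:Z - x) z != 0 ->
  exists s : seq (int * int * int), [/\ uniq s, (r.+1 ^ 2 <= 32 * size s)%N
    & all (fun p : int * int * int => [&& v p.1.1 p.1.2 p.2 != 0, `|p.1.1| <= 2 * r%:Z,
        `|p.1.2| <= 2 * r%:Z & `|p.2| <= R]) s].
Proof.
(* After at most M = r / 8 steps from the middle of the face the descent is
   still at distance more than M from both ends of its row. *)
move=> vt van r16 rR z0 zR x1 xr vx; pose M := (r %/ 8)%N; pose x0 : int := (r %/ 2)%N.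
have M8 : (M * 8 <= r < M.+1 * 8)%N by rewrite leq_trunc_div ltn_ceil.
have x02 : x0 + x0 <= r%:Z /\ r%:Z <= x0 + x0 + 1 by rewrite /x0; lia.
have vx0 : v x0 (r%:Z - x0) z != 0.
  have E t : 1 <= t -> t <= r%:Z - 1 -> v t (r%:Z - t) z = v 1 (r%:Z - 1) z.
    by move=> t1 tr; apply: (@first_layer v r R vt van) => //; lia.
  by rewrite E -1?(E x) //; lia.
have [||||||||||||s [us sP ss]] := @chain_support v r R vt van M x0 (r%:Z - x0) z _ _ _ _
  _ _
    M 0 x0 (r%:Z - x0) z _ vx0; try lia.
exists s; split=> //; last first.
  apply: sub_all sP => p /andP[_ /and4P[-> p1 p2 p3]] /=; lia.
have h1 : (r.+1 <= 8 * M.+1)%N by lia.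
have h2 : (r.+1 <= 4 * (r - 3 - 2 * M))%N by lia.
have h3 : (M.+1 * (r - 3 - 2 * M) <= size s)%N.
  by move: ss; have -> : r%:Z - 3 - 2 * M%:Z = (r - 3 - 2 * M)%N by lia.
rewrite expnS expn1; apply: leq_trans (leq_mul h1 h2) _.
by rewrite mulnACA leq_mul2l h3 orbT.
Qed.

(** Reflections bring the given nonzero value into the quadrant and above
    height zero. For small [r] that value alone is enough. *)
Lemma octa_support v (r : nat) (R : int) x y z : tilted v ->
  (forall x y z, `|x| + `|y| < r%:Z -> `|x| + `|y| + `|z| <= R -> v x y z = 0) ->
  4 * r%:Z <= R -> `|x| + `|y| = r%:Z -> r%:Z + `|z| <= R -> v x y z != 0 ->
  exists s : seq (int * int * int), [/\ uniq s, (r.+1 ^ 2 <= 256 * size s)%N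
    & all (fun p : int * int * int => [&& v p.1.1 p.1.2 p.2 != 0, `|p.1.1| <= 2 * r%:Z,
        `|p.1.2| <= 2 * r%:Z & `|p.2| <= R]) s].
Proof.
move=> vt van rR xyr zR v0; have [r16|r16] := leqP 16 r; last first.
  exists [:: (x, y, z)]; split=> //=; first by nia.
  by rewrite v0 /=; lia.
(* At a corner the equation one step towards the axis has only two further
   terms, one on each of the adjacent open faces; they cannot both vanish. *)
have [x' [y' [x'0 y'0 xyr' v0']]] : exists x' y', [/\ x' != 0, y' != 0,
  `|x'| + `|y'| = r%:Z & v x' y' z != 0].
  have [x0|x0] := eqVneq x 0.
    pose t := if 0 <= y then y - 1 else y + 1.
    have := vt 0 t z; rewrite ![v 0 t _]van; try by rewrite /t; case: ifP; lia.
    have -> : v 0 (t + 1) z + v 0 (t - 1) z = v x y z.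
      rewrite x0 /t; case: ifP => ty;
        [rewrite [v 0 (_ - 1 - 1) _]van|rewrite [v 0 (_ + 1 + 1) _]van]; try lia.
        by rewrite subrK addr0.
      by rewrite addrK add0r.
    rewrite mulr0 !addr0 add0r => E.
    have [h|h] := eqVneq (v 1 t z) 0.
      exists (-1), t; split=> //; try by rewrite /t; case: ifP; lia.
      by apply: contraNneq v0 => h'; move: E; rewrite h h' !subr0 => ->.
    by exists 1, t; split=> //; rewrite /t; case: ifP; lia.
  have [y0|y0] := eqVneq y 0; last by exists x, y.
  pose t := if 0 <= x then x - 1 else x + 1.
  have := vt t 0 z; rewrite ![v t 0 _]van; try by rewrite /t; case: ifP; lia.
  rewrite mulr0 !addr0 -addrA -opprD.
  have -> : v (t + 1) 0 z + v (t - 1) 0 z = v x y z.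
    rewrite y0 /t; case: ifP => ty;
      [rewrite [v (_ - 1 - 1) _ _]van|rewrite [v (_ + 1 + 1) _ _]van]; try lia.
      by rewrite subrK addr0.
    by rewrite addrK add0r.
  rewrite add0r => E.
  have [h|h] := eqVneq (v t 1 z) 0.
    exists t, (-1); split=> //; try by rewrite /t; case: ifP; lia.
    by apply: contraNneq v0 => h'; move: E; rewrite h h' add0r => /eqP;
      rewrite subr_eq0 => /eqP <-.
  by exists t, 1; split=> //; rewrite /t; case: ifP; lia.
pose sg (t : int) : int := if 0 <= t then 1 else -1.
have sgP t : is_sign (sg t) by rewrite /sg /is_sign; case: ifP.
have sgE t : sg t * `|t| = t by rewrite /sg; case: ifP; lia.
have sgN t a : `|sg t * a| = `|a| by rewrite /sg; case: ifP; lia.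
pose S := (sg x', sg y', sg z); pose w := reflect3 S v.
have [|||||||||s [us ss sP]] := @face_support w r R `|x'| `|z|.
- by apply: tilted_reflect => /=.
- by move=> a b c h1 h2; rewrite /w /reflect3 van ?sgN.
- by [].
- by [].
- by [].
- by [].
- by lia.
- by lia.
- by rewrite /w /reflect3 /= (_ : r%:Z - `|x'| = `|y'|) ?sgE //; lia.
exists [seq (sg x' * p.1.1, sg y' * p.1.2, sg z * p.2) | p <- s]; split.
- rewrite map_inj_uniq // => -[[a b] c] [[a' b'] c'] /= [].
  by rewrite /sg; do 3!case: ifP => _; move=> *; congr (_, _, _); lia.
- by rewrite size_map (leq_trans ss) // leq_mul2r orbT.
- by rewrite all_map; apply: sub_all sP => p /=; rewrite /w /reflect3 /= !sgN.
Qed.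
End Tilted.

(** * Covering by octahedra *)

Section Vitali.
Local Open Scope nat_scope.
Variables (T P : finType) (rho : T -> nat) (near : T -> {set T}) (ball : T ->
  {set P}) (C : nat).
Hypotheses (near_ball : forall c, #|near c| <= C * #|ball c|) (near_refl : forall c,
  c \in near c).
Hypothesis far_disjoint : forall c c', rho c' <= rho c -> c' \notin near c ->
  [disjoint ball c' & ball c].

(** Keep the ball of largest radius, discard the centres near it, and repeat
    with the others. *)
Lemma vitali (G : {set T}) : #|G| <= C * #|\bigcup_(c in G) ball c|.
Proof.
have [m Gm] := ubnP #|G|; elim: m G Gm => // m IH G Gm.
have [->|[c0 c0G]] := finset.set_0Vmem G; first by rewrite cards0.
case: (@arg_maxnP _ c0 (mem G) rho c0G) => c cG cmax.
set G' := G :\: near c; have G'G : #|G'| < #|G|.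
  apply: proper_card; apply/properP; split; first exact: finset.subsetDl.
  by exists c => //; rewrite finset.in_setD near_refl.
have dis : [disjoint \bigcup_(c in G') ball c & ball c].
  rewrite disjoint_sym; apply: bigcup_disjoint => c';
    rewrite disjoint_sym finset.in_setD => /andP[c'n c'G].
  by apply: far_disjoint => //; apply: cmax.
apply: leq_trans (_ : #|near c| + #|G'| <= _).
  by rewrite -(cardsID (near c) G) leq_add2r subset_leq_card // finset.subsetIr.
apply: leq_trans (leq_add (near_ball c) (IH _ (leq_trans G'G Gm))) _.
rewrite -mulnDr leq_mul2l; apply/orP; right; rewrite addnC -cardsUI.
rewrite (eqP (_ : _ :&: _ == finset.set0)) ?setI_eq0 // cards0 addn0.
apply: subset_leq_card; rewrite finset.subUset finset.bigcup_sup // andbT.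
by apply/bigcupsP => c'; rewrite finset.in_setD => /andP[_ c'G]; apply: finset.bigcup_sup.
Qed.
End Vitali.

Section Dim3.
Variables (F : numFieldType) (n : nat) (u : fn F 3).
Hypothesis lap_u : lap u = 0.
Hypothesis u0 : u 0 != 0.

Definition row3 (x y z : int) : 'rV[int]_3 := \row_i [:: x; y; z]`_i.

Lemma row3_inj x y z x' y' z' : row3 x y z = row3 x' y' z' -> [/\ x = x', y = y' & z = z'].
Proof.
move/rowP => h; have := h 0; have := h 1; have := h 2.
by rewrite !mxE /= => -> -> ->.
Qed.

(** The function [u], seen from the axis over [(a, b)] and with the signs that
    make it [tilted]. *)
Definition tilt (a b : int) (x y z : int) : F := (-1) ^ x * u (row3 (a + x) (b + y) z).

Lemma tilted_tilt a b : tilted (tilt a b).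
Proof.
move=> x y z; rewrite /tilt !expfzDr ?oppr_eq0 ?oner_eq0 //.
have := congr1 (fun f : fn F 3 => f (row3 (a + x) (b + y) z)) lap_u.
rewrite lapE !big_ord_recl big_ord0.
have E (i : 'I_3) p q r p' q' r' : (forall k : 'I_3, [:: p; q;
  r]`_k + (k == i)%:R = [:: p'; q'; r']`_k) ->
    row3 p q r + bv i = row3 p' q' r'.
  by move=> h; apply/rowP => k; rewrite !mxE -h.
have E' (i : 'I_3) p q r p' q' r' : (forall k : 'I_3, [:: p; q;
  r]`_k - (k == i)%:R = [:: p'; q'; r']`_k) ->
    row3 p q r - bv i = row3 p' q' r'.
  by move=> h; apply/rowP => k; rewrite !mxE -h.
rewrite (@E 0 _ _ _ (a + (x + 1)) (b + y) z); last by case=> -[|[|[]]] //= _; lia.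
rewrite (@E' 0 _ _ _ (a + (x - 1)) (b + y) z); last by case=> -[|[|[]]] //= _; lia.
rewrite (@E _ _ _ _ (a + x) (b + (y + 1)) z); last by case=> -[|[|[]]] //= _; lia.
rewrite (@E' _ _ _ _ (a + x) (b + (y - 1)) z); last by case=> -[|[|[]]] //= _; lia.
rewrite (@E _ _ _ _ (a + x) (b + y) (z + 1)); last by case=> -[|[|[]]] //= _; lia.
rewrite (@E' _ _ _ _ (a + x) (b + y) (z - 1)); last by case=> -[|[|[]]] //= _; lia.
move=> /eqP; rewrite subr_eq0 => /eqP h.
rewrite [6%:R * _]mulrCA -h.
have -> : (-1) ^ (-1 : int) = -1 :> F by rewrite exprN1 invrN1.
rewrite expr1z; ring.
Qed.

(* The octahedra of radius n around the axes over [-L, L]^2 contain the origin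
   within half their radius, and the balls below stay inside the box. *)
Let L := (n %/ 8)%N.
Notation T := ('I_(L.*2).+1 * 'I_(L.*2).+1)%type.
Definition cx (c : T) : int := (c.1 : nat)%:Z - L%:Z.
Definition cy (c : T) : int := (c.2 : nat)%:Z - L%:Z.
Notation v c := (tilt (cx c) (cy c)).

Definition lateral c m := `[< exists x y z, [/\ v c x y z != 0, `|x| + `|y| = m%:Z
  & `|x| + `|y| + `|z| <= n%:Z] >].

Lemma tilt_origin c : v c (- cx c) (- cy c) 0 != 0.
Proof.
rewrite /tilt !subrr mulf_neq0 //; first by rewrite expfz_neq0 // oppr_eq0 oner_eq0.
rewrite (_ : row3 0 0 0 = 0) //; apply/rowP => -[[|[|[]]]] //= ?; by rewrite !mxE.
Qed.

Lemma c_bounds c : `|cx c| <= L%:Z /\ `|cy c| <= L%:Z.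
Proof.
by rewrite /cx /cy; have := ltn_ord c.1; have := ltn_ord c.2; lia.
Qed.

Lemma ex_lateral c : exists m, lateral c m.
Proof.
have [h1 h2] := c_bounds c.
exists (`|cx c| + `|cy c|)%N; apply/asboolP; exists (- cx c), (- cy c), 0; split.
- exact: tilt_origin.
- by rewrite !normrN; lia.
- rewrite !normrN normr0; lia.
Qed.

(** The lateral distance from the axis over [c] to the closest nonzero value
    in the octahedron of radius [n]. This octahedron contains the origin,
    where [u] does not vanish. *)
Definition rad c := ex_minn (ex_lateral c).

Lemma rad_le c : (rad c <= L.*2)%N.
Proof.
rewrite /rad; case: ex_minnP => m _ mmin; have [h1 h2] := c_bounds c.
apply: leq_trans (mmin (`|cx c| + `|cy c|)%N _) _; last by lia.
apply/asboolP; exists (- cx c), (- cy c), 0; split; [exact: tilt_origin|rewrite !normrN;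
  lia|rewrite !normrN normr0; lia].
Qed.

Definition ball c : {set box 3 n} := [set b in supp_box n u |
  (`|pt b 0 0 - cx c| <= 2 * (rad c)%:Z) && (`|pt b 0 1 - cy c| <= 2 * (rad c)%:Z)].

(** The minimality of [rad c] is the vanishing required by [octa_support]. *)
Lemma ball_large c : ((rad c).+1 ^ 2 <= 256 * #|ball c|)%N.
Proof.
have [x [y [z [v0 xyr xyz van]]]] : exists x y z, [/\ v c x y z != 0,
  `|x| + `|y| = (rad c)%:Z,
   `|x| + `|y| + `|z| <= n%:Z & forall x y z,
     `|x| + `|y| < (rad c)%:Z -> `|x| + `|y| + `|z| <= n%:Z -> v c x y z = 0].
  rewrite /rad; case: ex_minnP => m /asboolP[x [y [z [v0 h1 h2]]]] mmin.
  exists x, y, z; split=> // x' y' z' h3 h4; apply/eqP; apply: contraT => v0'.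
  have := mmin (`|x'| + `|y'|)%N; rewrite leqNgt (_ : _ < m = true)%N ?implybF; last by lia.
  case/(_ _)/negP => //.
  by apply/asboolP; exists x', y', z'; split=> //; lia.
have [h1 h2] := c_bounds c; have h3 := rad_le c.
have [|| s [us ss sP]] := octa_support (@tilted_tilt _ _) van _ xyr _ v0.
- by rewrite /L in h3; lia.
- by lia.
apply: leq_trans ss _; rewrite leq_mul2l /=.
pose f (p : int * int * int) : 'rV[int]_3 := row3 (cx c + p.1.1) (cy c + p.1.2) p.2.
have fB p : p \in s -> exists b, b \in ball c /\ pt b = f p.
  move=> /(allP sP)/and4P[pv p1 p2 p3].
  have [b bE] : exists b : box 3 n, pt b = f p.
    apply: ptP; apply/forallP => -[[|[|[|]]]] //= i; rewrite !mxE /=;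
      rewrite /L in h1 h2 h3; lia.
  exists b; split=> //; rewrite inE inE bE /f !mxE /=; apply/andP; split; last by lia.
  by move: pv; rewrite /tilt mulf_eq0 negb_or => /andP[].
pose g p := odflt (\row_(i < 3) ord0) [pick b | (b \in ball c) && (pt b == f p)].
have gP p : p \in s -> g p \in ball c /\ pt (g p) = f p.
  move=> /fB[b [b1 b2]]; rewrite /g; case: pickP => [b' /andP[? /eqP ?] //|/(_ b)].
  by rewrite b1 b2 eqxx.
have -> : size s = size (map g s) by rewrite size_map.
have ug : uniq (map g s).
  rewrite map_inj_in_uniq // => p q /gP[_ p2] /gP[_ q2] pq; move: p2; rewrite pq q2 /f.
  move/row3_inj => [/addrI e1 /addrI e2 e3]; move: e1 e2 e3.
  by case: p q {pq q2} => [[? ?] ?] [[? ?] ?] /= -> -> ->.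
rewrite -(card_uniqP ug); apply: subset_leq_card; apply/fintype.subsetP => _ /mapP[p ps ->].
by case: (gP p ps).
Qed.

Definition near (c : T) : {set T} := [set c' : T |
  (`|cx c' - cx c| <= 4 * (rad c)%:Z) && (`|cy c' - cy c| <= 4 * (rad c)%:Z)].

Lemma near_card c : (#|near c| <= 64 * (rad c).+1 ^ 2)%N.
Proof.
set r := rad c; pose B : finType := 'I_(8 * r).+1.
pose f (c' : T) : B * B :=
  (inord (absz (cx c' - cx c + 4 * r%:Z)%R), inord (absz (cy c' - cy c + 4 * r%:Z)%R)).
have fi : {in near c &, injective f}.
  move=> [a b] [a' b']; rewrite !inE /f /cx /cy /= -/r => /andP[h1 h2] /andP[h3 h4] [].
  move/(congr1 val) => /=; rewrite !inordK; try lia.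
  move=> e1; move/(congr1 val) => /=; rewrite !inordK; try lia.
  by move=> e2; congr (_, _); apply: val_inj => /=; lia.
rewrite -(card_in_imset fi); apply: leq_trans (max_card _) _.
rewrite card_prod card_ord -/r; nia.
Qed.

Theorem support_bound3 : (n ^ 2 <= 64 * (64 * 256 * #|supp_box n u|))%N.
Proof.
have V := @vitali _ _ rad near ball (64 * 256) _ _ _ [set: T].
have : (#|[set: T]| <= 64 * 256 * #|\bigcup_(c in [set: T]) ball c|)%N.
  apply: V.
  - move=> c; apply: leq_trans (near_card c) _.
    by rewrite -mulnA leq_mul2l /= ball_large.
  - by move=> c; rewrite inE !subrr normr0; lia.
  - move=> c c' rr; rewrite inE -[in X in X -> _]implybF.
    move=> far; rewrite -setI_eq0; apply/eqP/setP => b; rewrite !inE.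
    apply/negP => /andP[/andP[_ /andP[h1 h2]] /andP[_ /andP[h3 h4]]].
    by move: far; rewrite implybF => /negP; apply; lia.
have -> : #|[set: T]| = ((L.*2).+1 ^ 2)%N by rewrite cardsT card_prod !card_ord.
have : (#|\bigcup_(c in [set: T]) ball c| <= #|supp_box n u|)%N.
  by apply: subset_leq_card; apply/bigcupsP => c _; apply/fintype.subsetP => b;
    rewrite inE => /andP[].
have : (n <= 8 * (L.*2).+1)%N by rewrite /L; lia.
move: #|_| #|_| => a b h1 h2 h3.
apply: leq_trans (_ : (8 * (L.*2).+1) ^ 2 <= _)%N; first by rewrite leq_exp2r.
rewrite expnMn leq_mul2l; apply: leq_trans h3 _; by rewrite leq_mul2l h2 orbT.
Qed.
End Dim3.

(** * A harmonic function with small support *)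

Section Sparse.
Variables (F : numFieldType) (d : nat) (lam : F).
Notation Z := 'rV[int]_d.+1.
Hypothesis lam0 : lam != 0.

Definition paired (x : Z) := [forall p : 'I_d.+1, forall q : 'I_d.+1,
  (odd p && (q == p.+1 :> nat)) ==> (x 0 p == x 0 q)].
Definition parity (x : Z) : int := \sum_(p < d.+1 | odd p && (p < d)%N) x 0 p.
(** The coordinates 1 and 2, 3 and 4, and so on are paired, and coordinate 0
    carries the exponential. If the dimension [d.+1] is even, then the last
    coordinate has no partner and no influence. *)
Definition sparse : fn F d.+1 := fun x =>
  if paired x then lam ^ (x 0 0) * (-1) ^ parity x else 0.

Definition unit_at (i : nat) : Z := \row_k (k == i :> nat)%:R.

Lemma bv_unit_at i : bv i = unit_at i :> Z.
Proof. by apply/rowP => k; rewrite !mxE eqxx. Qed.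

Lemma sparse_trans (a : Z) : (forall p q : 'I_d.+1,
  odd p -> q = p.+1 :> nat -> a 0 p = a 0 q) ->
  forall x, sparse (x + a) = lam ^ (a 0 0) * (-1) ^ parity a * sparse x.
Proof.
move=> ha x; rewrite /sparse.
have -> : paired (x + a) = paired x.
  apply: eq_forallb => p; apply: eq_forallb => q; case: (boolP (odd p)) => //= op.
  case: eqP => //= qp; rewrite !mxE (ha p q) //.
  by apply/eqP/eqP => [/addIr|->].
case: ifP => _; last by rewrite mulr0.
have -> : parity (x + a) = parity x + parity a.
  by rewrite /parity -big_split; apply: eq_bigr => p _; rewrite mxE.
have N0 : -1 != 0 :> F by rewrite oppr_eq0 oner_eq0.
rewrite mxE (expfzDr _ _ lam0) (expfzDr _ _ N0); ring.
Qed.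

Lemma sparse_axis x : sparse (x + unit_at 0) = lam * sparse x.
Proof.
rewrite sparse_trans => [|p q op qp].
  rewrite mxE /parity big1 ?expr0z ?mulr1 ?expr1z // => p /andP[op _].
  by rewrite mxE; case: eqP op => // ->.
by rewrite !mxE qp; case: eqP op => // ->.
Qed.

Lemma sparse_pair t x : (2 * t + 2 < d.+1)%N ->
  sparse (x + (unit_at (2 * t + 1) + unit_at (2 * t + 2))) = - sparse x.
Proof.
move=> td; rewrite sparse_trans => [|p q op qp].
  rewrite !mxE /= addn1 addn2 addr0 expr0z mul1r.
  have tp : ((2 * t).+1 < d.+1)%N by lia.
  rewrite /parity (bigD1 (Ordinal tp)) /=; last by rewrite oddM /=; lia.
  rewrite big1 => [|p /andP[/andP[op _] pt]].
    by rewrite !mxE /= eqxx addr0 (_ : _ == _ = false) ?addr0 ?expr1z ?mulN1r //; lia.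
  have pt' : (p == (2 * t).+1 :> nat) = false.
    by apply/negbTE; apply: contraNN pt => /eqP pE; apply/eqP/val_inj.
  by rewrite !mxE pt' (_ : (_ == _) = false) //; lia.
rewrite !mxE qp.
have -> : (p == (2 * t + 2)%N :> nat) = false by lia.
have -> : (p.+1 == (2 * t + 1)%N :> nat) = false by lia.
by rewrite addn2 addn1 eqSS addr0 add0r.
Qed.

Lemma sparse_last x : odd d -> sparse (x + unit_at d) = sparse x.
Proof.
move=> od; rewrite sparse_trans => [|p q op qp].
  rewrite mxE /parity big1 => [|p /andP[_ pd]].
    by rewrite /= (_ : (0%N == d) = false) ?expr0z ?mul1r //; case: (d) od.
  by rewrite mxE (_ : (_ == _) = false) //; lia.
have := ltn_ord q; rewrite !mxE qp => qd.
have -> : (p == d :> nat) = false by lia.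
by have -> : (p.+1 == d) = false by lia.
Qed.

Lemma big_pairs (V : nmodType) (g : nat -> V) m :
  \sum_(1 <= i < (2 * m).+1) g i = \sum_(t < m) (g (2 * t + 1)%N + g (2 * t + 2)%N).
Proof.
elim: m => [|m IH]; first by rewrite big_ord0 big_geq.
rewrite big_ord_recr /= -IH mulnS add2n.
rewrite (big_nat_recr (2 * m).+2) //= (big_nat_recr (2 * m).+1) //=.
by rewrite addrA addn1 addn2.
Qed.

(** Within a pair the four neighbours cancel in twos, since translation along
    both coordinates of a pair changes the sign. The exponential contributes
    [lam + lam^-1] and an unpaired last coordinate 2. *)
Lemma lap_sparse : (0 < d)%N -> lam + lam^-1 = (if odd d then 2 * d else 2 * d.+1)%:R ->
  lap sparse = 0.
Proof.
move=> d0 hlam; apply/funext => x; rewrite lapE !fnE.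
pose G i := sparse (x + unit_at i) + sparse (x - unit_at i).
have -> : \sum_i (sparse (x + bv i) + sparse (x - bv i)) = \sum_(0 <= i < d.+1) G i.
  by rewrite big_mkord; apply: eq_bigr => i _; rewrite bv_unit_at.
have G0 : G 0%N = (lam + lam^-1) * sparse x.
  by rewrite /G sparse_axis mulrDl; congr (_ + _);
    rewrite -{2}(subrK (unit_at 0) x) sparse_axis mulKf.
have Gp t : (2 * t + 2 < d.+1)%N -> G (2 * t + 1)%N + G (2 * t + 2)%N = 0.
  move=> td; rewrite /G; set a := unit_at _; set b := unit_at (2 * t + 2).
  have -> : x + a = x - b + (a + b) by rewrite [a + b]addrC addrA subrK.
  have -> : x + b = x - a + (a + b) by rewrite addrA subrK.
  by rewrite !sparse_pair //; ring.
pose m := d./2.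
have sum_pairs : \sum_(1 <= i < (2 * m).+1) G i = 0.
  by rewrite big_pairs big1 // => t _; apply: Gp; have := ltn_ord t; rewrite /m; lia.
rewrite big_ltn // G0.
have [od|od] := boolP (odd d).
  have E k : k = (2 * m).+1 -> \sum_(1 <= i < k.+1) G i = G k.
    by move=> ->; rewrite big_nat_recr //= sum_pairs add0r.
  rewrite E; last by rewrite /m; lia.
  have -> : G d = 2%:R * sparse x.
    have := sparse_last (x - unit_at d) od.
    by rewrite subrK /G sparse_last // => ->; rewrite mulr_natl mulr2n.
  by rewrite hlam od -mulrDl -natrD (_ : (2 * d + 2 = 2 * d.+1)%N) ?subrr //; lia.
have E k : k = (2 * m)%N -> \sum_(1 <= i < k.+1) G i = 0 by move=> ->.
by rewrite E ?addr0 ?hlam ?(negbTE od) ?subrr // /m; lia.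
Qed.

(** The coordinates that determine a point of the support: 0 and the odd ones. *)
Definition coord (t : 'I_((d.+1)./2.+1)) : 'I_d.+1 := inord (if t == 0 :> nat then 0 else
  2 * t - 1)%N.

Lemma supp_sparse n : (#|supp_box n sparse| <= (n.*2).+1 ^ (d.+1)./2.+1)%N.
Proof.
pose f (b : box d.+1 n) : {ffun 'I_((d.+1)./2.+1) ->
  'I_(n.*2).+1} := [ffun t => b 0 (coord t)].
have fi : {in supp_box n sparse &, injective f}.
  move=> b b'; rewrite !inE /sparse; case: ifP => [pb _|]; last by rewrite eqxx.
  case: ifP => [pb' _|]; last by rewrite eqxx.
  move/ffunP => h.
  have H (k : 'I_d.+1) : (k == 0 :> nat) || odd k -> b 0 k = b' 0 k.
    move=> hk; have kt : ((k.+1)./2 < (d.+1)./2.+1)%N by have := ltn_ord k; lia.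
    have := h (Ordinal kt); rewrite !ffunE (_ : coord _ = k) //.
    apply: val_inj; rewrite /coord /= inordK; case: ifP; have := ltn_ord k; lia.
  apply: (@pt_inj d.+1 n); apply/rowP => q;
    have [hq|hq] := boolP ((q == 0 :> nat) || odd q).
    by rewrite !mxE H.
  have pq : (q.-1 < d.+1)%N by have := ltn_ord q; lia.
  have hp : odd (Ordinal pq) && (q == (Ordinal pq).+1 :> nat) by rewrite /=; lia.
  have /implyP/(_ hp)/eqP <- := forallP (forallP pb (Ordinal pq)) q.
  have /implyP/(_ hp)/eqP <- := forallP (forallP pb' (Ordinal pq)) q.
  by rewrite !mxE H //; case/andP: hp => ->; rewrite orbT.
rewrite -(card_in_imset fi); apply: leq_trans (max_card _) _.
by rewrite card_ffun !card_ord.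
Qed.

Lemma sparse0 : sparse 0 != 0.
Proof.
rewrite /sparse ifT; last by apply/forallP => p; apply/forallP => q;
  rewrite !mxE eqxx implybT.
by rewrite mulf_neq0 // expfz_neq0 // oppr_eq0 oner_eq0.
Qed.
End Sparse.

(** The eigenvalue equation for [lam] is quadratic, and its roots are inverse
    to each other. *)
Theorem sparse_harmonic (F : numClosedFieldType) d : (0 < d)%N ->
  exists u : fn F d.+1, [/\ lap u = 0, u 0 != 0 &
    forall n, (#|supp_box n u| <= (n.*2).+1 ^ (d.+1)./2.+1)%N].
Proof.
move=> d0; pose c : F := (if odd d then 2 * d else 2 * d.+1)%:R.
pose lam : F := (c + sqrtC (c ^+ 2 - 4%:R)) / 2%:R.
have lamE : lam * (c - lam) = 1.
  have := sqrtCK (c ^+ 2 - 4%:R); rewrite /lam; set s := sqrtC _ => h.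
  have -> : (c + s) / 2%:R * (c - (c + s) / 2%:R) = (c ^+ 2 - s ^+ 2) / 4%:R by field.
  by rewrite h opprB addrC subrK divff // pnatr_eq0.
have lam0 : lam != 0 by apply: contra_eq_neq lamE => ->; rewrite mul0r eq_sym oner_eq0.
exists (sparse (d := d) lam); split.
- apply: lap_sparse => //; rewrite -/c.
  by rewrite (_ : lam^-1 = c - lam) ?[lam + _]addrC ?subrK // -[RHS](mulKf lam0) lamE mulr1.
- exact: sparse0.
- exact: supp_sparse.
Qed.

(** * Bounds on the minimal support *)

From mathcomp Require Import finmap complex.
From mathcomp Require Import all_reals all_analysis.

Section Link.
Variables (R : realType) (d : nat).
Notation C := (R[i]).

Lemma harmonicE (u : 'rV[int]_d -> C) : discrete_harmonic u <-> lap (u : fn C d) = 0.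
Proof.
split=> [h|h x].
  by apply/funext => x; rewrite lapE fnE -[\sum_i _]/(adjacency u x) h subrr.
have := congr1 (fun f : fn C d => f x) h; rewrite lapE fnE => /eqP.
by rewrite subr_eq0 => /eqP.
Qed.

Lemma card_supp_cube n (u : 'rV[int]_d -> C) :
  #|` fset_set (supp u `&` cube d n)| = #|supp_box n (u : fn C d)|.
Proof.
have -> : fset_set (supp u `&` cube d n) =
  seq_fset tt [seq pt b | b <- enum (supp_box n (u : fn C d))].
  apply/fsetP => x; rewrite seq_fsetE in_fset_set; last first.
    by apply: sub_finite_set (@finite_cube d n); exact: subIsetr.
  apply/idP/mapP => [|[b]].
    rewrite in_setE => -[/= ux xQ]; have [b bx] : exists b : box d n, pt b = x.
      by apply: ptP; apply/forallP => i; rewrite ler_norml; exact: xQ.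
    by exists b => //; rewrite mem_enum finset.inE bx.
  rewrite mem_enum finset.inE => ub ->; apply/mem_set; split=> //= i.
  by have /forallP/(_ i) := inQ_pt b; rewrite ler_norml.
rewrite size_seq_fset undup_id ?size_map -?cardE // map_inj_uniq ?enum_uniq //.
exact: pt_inj.
Qed.

Lemma min_support_ge n (c : R) : (exists u : fn C d, lap u = 0 /\ u 0 != 0) ->
  (forall u : fn C d, lap u = 0 -> u 0 != 0 -> c <= #|supp_box n u|%:R) ->
  c <= min_support R d n.
Proof.
move=> [u [hu u0]] h; apply: lb_le_inf.
  by exists #|supp_box n u|%:R; exists u; split=> //;
    [apply/harmonicE|rewrite card_supp_cube].
by move=> _ [v [/harmonicE hv v0 ->]]; rewrite card_supp_cube; apply: h.
Qed.

Lemma min_support_le n (c : R) (u : fn C d) : lap u = 0 -> u 0 != 0 ->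
  #|supp_box n u|%:R <= c -> min_support R d n <= c.
Proof.
move=> hu u0; apply: le_trans; apply: ge_inf.
  by exists 0 => _ [v [_ _ ->]]; rewrite ler0n.
by exists u; split=> //; [apply/harmonicE|rewrite card_supp_cube].
Qed.
End Link.

Lemma exponentE (R : realType) d : (4 <= d)%N ->
  ((K d)%:R - delta R d) * (2 * d).-1%:R = (d * d)%:R.
Proof.
move=> d4; rewrite /delta ltnNge d4 /= /K.
have -> : (2 * d).-1%:R = 2 * d%:R - 1 :> R.
  by rewrite -subn1 natrB ?natrM //; lia.
have n0 : 2 * d%:R - 1 != 0 :> R.
  rewrite subr_eq0 -natrM -[1]/(1%:R) eqr_nat; lia.
have dE : d%:R = (odd d)%:R + (d %/ 2)%:R * 2 :> R.
  by rewrite -natrM -natrD; congr _%:R; lia.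
rewrite -natr1 natrM; move: n0; rewrite dE; move: (d %/ 2)%:R => k.
by case: (odd d); rewrite ?[false%:R]mulr0n ?[true%:R]mulr1n ?add0r => n0; field.
Qed.

Theorem theorem1p1 (R : realType) (d : nat) (hd : (3 <= d)%N) :
  exists c : R, 0 < c /\
    forall n : nat, (1 <= n)%N ->
      c * n%:R `^ ((K d)%:R - delta R d) <= min_support R d n /\
      min_support R d n <= (2 * n%:R + 1) ^+ K d.
Proof.
have [w [hw w0 sw]] : exists u : fn R[i] d, [/\ lap u = 0, u 0 != 0 &
    forall n, (#|supp_box n u| <= (n.*2).+1 ^ K d)%N].
  have -> : K d = (d./2).+1 by rewrite /K divn2.
  case: d hd => // d' hd; apply: sparse_harmonic; lia.
have upper n : min_support R d n <= (2 * n%:R + 1) ^+ K d.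
  apply: (min_support_le hw w0); rewrite -natrM natr1 -natrX ler_nat mul2n; exact: sw.
suff [c [c0 hc]] : exists c : R, 0 < c /\ forall n (u : fn R[i] d), (1 <= n)%N ->
    lap u = 0 -> u 0 != 0 -> c * n%:R `^ ((K d)%:R - delta R d) <= #|supp_box n u|%:R.
  exists c; split=> // n n1; split; last exact: upper.
  by apply: min_support_ge; [exists w|move=> u; apply: hc].
have [d3|d4] : d = 3%N \/ (4 <= d)%N by lia.
  rewrite {}d3; pose C := (64 * (64 * 256))%N; exists (C%:R^-1); split.
    by rewrite invr_gt0 ltr0n.
  move=> n u n1 hu u0; rewrite /K /delta /= subr0 powR_mulrn // mulrC ler_pdivrMr ?ltr0n //.
  rewrite -natrX -natrM ler_nat mulnC; apply: leq_trans (support_bound3 n hu u0) _.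
  by rewrite mulnA.
have [C C0 hC] := @support_bound R[i] d ltac:(lia).
have C0' : 0 < C%:R :> R by rewrite ltr0n.
exists C%:R^-1; split; first by rewrite invr_gt0.
move=> n u n1 hu u0; set N := #|_|.
have k0 : (0 < (2 * d).-1)%N by lia.
(* Raising to the power 2 d - 1 clears the denominator of the exponent. *)
rewrite mulrC ler_pdivrMr // -(@ler_pXn2r _ (2 * d).-1)
  ?nnegrE ?powR_ge0 ?mulr_ge0 ?ler0n //.
rewrite -powR_mulrn ?powR_ge0 // -powRrM exponentE // powR_mulrn //.
rewrite -natrX -natrM -natrX ler_nat; apply: leq_trans (hC n u hu u0) _.
rewrite mulnC expnMn leq_mul2l -/N; apply/orP; right.
by rewrite -{1}[C]expn1 leq_pexp2l.
Qed.
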